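(* Let $\gamma>-1$ and $\beta\in\mathbb{D}$. For the Weyl-type unitary operator $C_{\hat k^\gamma_\beta,\psi_{\beta,-1}}$ on $A^2_\gamma(\mathbb{D})$, $\mathbf{Ber}\left(C_{\hat k^\gamma_\beta,\psi_{\beta,-1}}\right)=(0,1]$.
   Context: $\mathbb{D}$ is the open unit disk and $\mathbb{T}$ the unit circle of $\mathbb{C}$; $dA$ is area measure on $\mathbb{D}$ normalized so that $\mathbb{D}$ has area $1$; $dA_\gamma(w)=(\gamma+1)(1-|w|^2)^\gamma dA(w)$. The weighted Bergman space $A^2_\gamma(\mathbb{D})$ is the Hilbert space of holomorphic functions $f$ on $\mathbb{D}$ with $\int_{\mathbb{D}}|f|^2dA_\gamma<\infty$, with inner product $\langle f,g\rangle=\int_{\mathbb{D}}f\bar g\,dA_\gamma$. Its normalized reproducing kernel at $\xi\in\mathbb{D}$ is $\hat k^\gamma_\xi(w)=\frac{(1-|\xi|^2)^{(\gamma+2)/2}}{(1-\bar\xi w)^{\gamma+2}}$ (principal branch of the power). For $\beta\in\mathbb{D}$, $\eta\in\mathbb{T}$, $\psi_{\beta,\eta}(w)=\eta\frac{w-\beta}{1-\bar\beta w}$, and the Weyl-type operator is $C_{\hat k^\gamma_\beta,\psi_{\beta,\eta}}f=\hat k^\gamma_\beta\,(f\circ\psi_{\beta,\eta})$ for $f\in A^2_\gamma(\mathbb{D})$. For a bounded linear operator $T$ on $A^2_\gamma(\mathbb{D})$, the Berezin transform is $\widetilde T(\xi)=\langle T\hat k^\gamma_\xi,\hat k^\gamma_\xi\rangle$,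 $\xi\in\mathbb{D}$, and the Berezin range is $\mathbf{Ber}(T)=\{\widetilde T(\xi):\xi\in\mathbb{D}\}$. *)

(* Defs.v *)
From HB Require Import structures.
From mathcomp Require Import all_boot all_order all_algebra.
From mathcomp Require Import complex.
From mathcomp Require Import all_classical all_reals all_analysis.
Set Implicit Arguments.
Unset Strict Implicit.
Unset Printing Implicit Defensive.
Import Order.TTheory GRing.Theory Num.Theory.
Import numFieldNormedType.Exports.
Local Open Scope classical_set_scope.
Local Open Scope ring_scope.
Local Open Scope complex_scope.

Section Bergman.
Variable R : realType.
Implicit Types (g s : R) (z w b e xi : R[i]).

Definition cmod z : R := Num.sqrt (complex.Re z ^+ 2 + complex.Im z ^+ 2).

Definition disk : set R[i] := [set z | cmod z < 1].

(* Principal argument, with values in ]-pi, pi] (for z != 0). *)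
Definition Carg z : R :=
  let t := acos (complex.Re z / cmod z) in
  if 0 <= complex.Im z then t else - t.

(* Principal branch of z ^ s, s real, for z != 0. *)
Definition cpow z s : R[i] :=
  (cmod z `^ s)%:C * (cos (s * Carg z) +i* sin (s * Carg z)).

(* The measure dA_g on the disk has density [density g] with respect to the
   Lebesgue measure of R x R: the factor pi^-1 normalizes the area of the disk
   to 1. *)
Definition density g z : R := (g + 1) / pi * (1 - cmod z ^+ 2) `^ g.

Definition area : {measure set (measurableTypeR R * measurableTypeR R) -> \bar R} :=
  ((@lebesgue_measure R) \x (@lebesgue_measure R))%E.

Definition planar_disk : set (R * R) := [set p | disk (p.1 +i* p.2)].

(* Integral over the disk of a nonnegative real function against dA_g; it may
   be infinite. *)
Definition disk_integral_ge0 g (F : R[i] -> R) : \bar R :=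
  (\int[area]_(p in planar_disk)
     (F (p.1 +i* p.2) * density g (p.1 +i* p.2))%:E)%E.

(* Integral over the disk of a complex function against dA_g. *)
Definition disk_integral g (F : R[i] -> R[i]) : R[i] :=
  (\int[area]_(p in planar_disk)
     (complex.Re (F (p.1 +i* p.2)) * density g (p.1 +i* p.2)))%R +i*
  (\int[area]_(p in planar_disk)
     (complex.Im (F (p.1 +i* p.2)) * density g (p.1 +i* p.2)))%R.

(* The scalars of [derivable] are the complex numbers here, so this is complex
   differentiability at every point of the disk. *)
Definition holomorphic_on_disk (f : R[i] -> R[i]) : Prop :=
  forall z, disk z -> derivable (f : R[i]^o -> R[i]^o) z 1.

(* Functions on the disk are represented by functions on R[i] whose values
   outside the disk play no role. *)
Definition is_bergman g (f : R[i] -> R[i]) : Prop :=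
  holomorphic_on_disk f /\
  (disk_integral_ge0 g (fun z => cmod (f z) ^+ 2)%R < +oo)%E.

Definition bergman g : Type := {f : R[i] -> R[i] | is_bergman g f}.

Lemma is_bergman0 g : is_bergman g (fun=> 0).
Proof.
split=> [z _|]; first exact: derivable_cst.
rewrite /disk_integral_ge0 integral0_eq ?ltry// => p _.
by rewrite /cmod /= expr0n addr0 sqrtr0 expr0n mul0r.
Qed.

(* f as an element of the Bergman space; the default value 0 is used only for
   functions that are not in the space. *)
Definition to_bergman g (f : R[i] -> R[i]) : bergman g :=
  match pselect (is_bergman g f) with
  | left h => exist _ f h
  | right _ => exist _ (fun=> 0) (is_bergman0 g)
  end.

Definition inner g (f h : bergman g) : R[i] :=
  disk_integral g (fun z => sval f z * (sval h z)^*).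

Definition nkernel g xi w : R[i] :=
  ((1 - cmod xi ^+ 2) `^ ((g + 2) / 2))%:C / cpow (1 - xi^* * w) (g + 2).

Definition psi b e w : R[i] := e * ((w - b) / (1 - b^* * w)).

(* Weighted composition operator f |-> u (f o phi) on the Bergman space. The
   default value of [to_bergman] is never reached when u = nkernel g b and
   phi = psi b e with -1 < g, |b| < 1 and |e| = 1: then f |-> u (f o phi) maps
   the space into itself. *)
Definition wcomp g (u phi : R[i] -> R[i]) (f : bergman g) : bergman g :=
  to_bergman g (fun w => u w * sval f (phi w)).

Definition weyl g b e : bergman g -> bergman g :=
  wcomp (nkernel g b) (psi b e).

(* For -1 < g and xi in the disk the normalized kernel is in the space, so that
   [to_bergman] is the plain injection here. *)
Definition berezin g (T : bergman g -> bergman g) xi : R[i] :=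
  let k := to_bergman g (nkernel g xi) in inner (T k) k.

Definition Ber g (T : bergman g -> bergman g) : set R[i] :=
  [set berezin T xi | xi in disk].

End Bergman.

Arguments weyl {R} g b e f.

(* Main.v *)
(* Write s = gamma + 2. The normalized kernels are multiples of the functions
   K_a(z) = (1 - conj(a) z)^(-s), and C k_xi is a multiple of K_a with
   a = (beta - xi) / (1 - xi conj(beta)), so its Berezin transform follows from
   <K_a, K_b> = (1 - conj(a) b)^(-s). To prove the latter, apply Stokes' theorem
   to the z-derivative of (1 - conj(a) z)^(1-s) conj((1 - conj(b) z)^(-1-s))
   (1 - |z|^2)^(s-1), whose weight vanishes on the circle: with
   P(z) = K_a(z) conj((1 - conj(b) z)^(-1-s)) this gives
   int conj(z) P = conj(a) int P. Hence t |-> <K_a, K_(tb)> (1 - t conj(a) b)^s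
   has derivative zero, and its value at 0 is 1 because dA_gamma is a
   probability measure.
   The Berezin transform is thus the s-th power of
   (1 - |xi|^2) sqrt(1 - |beta|^2) / (1 + |xi|^2 - 2 Re(conj(beta) xi)),
   which lies in ]0, 1] by Cauchy-Schwarz and takes each of these values on the
   line through 0 and beta. *)

Require Import Defs.
From HB Require Import structures.
From mathcomp Require Import all_boot all_order all_algebra.
From mathcomp Require Import complex ring lra.
From mathcomp Require Import all_classical all_reals all_analysis.
From mathcomp Require Import measurable_realfun.
Import Order.TTheory GRing.Theory Num.Theory.
Import numFieldNormedType.Exports.
Local Open Scope classical_set_scope.
Local Open Scope ring_scope.
Local Open Scope complex_scope.
(* Reopened so that [z^*] always denotes [Num.conj z]: [complex_scope] has its
   own conjugation, convertible but not syntactically equal to it. *)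
Local Open Scope ring_scope.

(** * Complex powers on the right half-plane *)

Section ComplexPowers.
Context {R : realType}.
Implicit Types (z w : R[i]) (s t : R).

(** The exponent -1-s in P is what closes the argument. The conjugate of K_b is P's second factor
    times 1 - b conj(z), and differentiating the conjugate of K_(tb) in t produces a multiple of
    conj(z) P; once the moment of conj(z) is known, the scalar product and its t-derivative are both
    multiples of the integral of P, and the product rule cancels. At t = 0 the scalar product is
    that of K_a with the constant 1, which is not yet a total mass: it is the conjugate of the case
    where the first parameter is 0. For gamma < 0 the density is unbounded near the circle. Hence
    the other factors are kept bounded, so that a multiple of the density is always an integrable
    majorant, and the integration by parts is done on smaller concentric disks. The mass is found
    from the image of the area under |z|^2. Principal powers are not multiplicative in general. All
    bases lie in the right half-plane, and a product of two of them is only ever compared with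
    another product of two. *)

Lemma ReD z w : complex.Re (z + w) = complex.Re z + complex.Re w.
Proof. by case: z; case: w. Qed.

Lemma ImD z w : complex.Im (z + w) = complex.Im z + complex.Im w.
Proof. by case: z; case: w. Qed.

Lemma ReN z : complex.Re (- z) = - complex.Re z.
Proof. by case: z. Qed.

Lemma ImN z : complex.Im (- z) = - complex.Im z.
Proof. by case: z. Qed.

Lemma ReM z w :
  complex.Re (z * w) = complex.Re z * complex.Re w - complex.Im z * complex.Im w.
Proof. by case: z; case: w. Qed.

Lemma ImM z w :
  complex.Im (z * w) = complex.Re z * complex.Im w + complex.Im z * complex.Re w.
Proof. by case: z => a b; case: w. Qed.

Lemma ReJ z : complex.Re z^* = complex.Re z.
Proof. by case: z. Qed.

Lemma ImJ z : complex.Im z^* = - complex.Im z.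
Proof. by case: z. Qed.

Lemma conj_real (x : R) : (x%:C : R[i])^* = x%:C.
Proof. exact: conjc_real. Qed.

Lemma conjM z w : (z * w)^* = z^* * w^*.
Proof. exact: rmorphM. Qed.

Lemma conjN z : (- z)^* = - z^*.
Proof. exact: rmorphN. Qed.

Lemma eqC z w : complex.Re z = complex.Re w -> complex.Im z = complex.Im w -> z = w.
Proof. by case: z => a b; case: w => c d /= -> ->. Qed.

Lemma rcD s t : (s + t)%:C = s%:C + t%:C :> R[i].
Proof. exact: rmorphD. Qed.

Lemma rcN s : (- s)%:C = - s%:C :> R[i].
Proof. exact: rmorphN. Qed.

Lemma rcM s t : (s * t)%:C = s%:C * t%:C :> R[i].
Proof. exact: rmorphM. Qed.

Lemma rcV s : s^-1%:C = s%:C^-1 :> R[i].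
Proof. exact: fmorphV. Qed.

Lemma cmodE z : `|z| = (cmod z)%:C.
Proof. exact: normc_def. Qed.

Lemma cmod_ge0 z : 0 <= cmod z.
Proof. exact: sqrtr_ge0. Qed.

Lemma cmodM z w : cmod (z * w) = cmod z * cmod w.
Proof. by apply: complexI; rewrite rcM -!cmodE normrM. Qed.

Lemma cmodV z : cmod z^-1 = (cmod z)^-1.
Proof. by apply: complexI; rewrite rcV -!cmodE normfV. Qed.

Lemma cmodJ z : cmod z^* = cmod z.
Proof. by rewrite /cmod ReJ ImJ sqrrN. Qed.

Lemma cmodN z : cmod (- z) = cmod z.
Proof. by rewrite /cmod ReN ImN !sqrrN. Qed.

Lemma le_cmodD z w : cmod (z + w) <= cmod z + cmod w.
Proof. by have := ler_normD z w; rewrite !cmodE -rcD lecR. Qed.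

Lemma cmod_real s : cmod s%:C = `|s|.
Proof. by rewrite /cmod /= expr0n addr0 sqrtr_sqr. Qed.

Lemma cmod0 : cmod (0 : R[i]) = 0.
Proof. by rewrite -[0]/(0%:C) cmod_real normr0. Qed.

Lemma cmod1 : cmod (1 : R[i]) = 1.
Proof. by rewrite -[1]/(1%:C) cmod_real normr1. Qed.

Lemma sqr_cmod z : cmod z ^+ 2 = complex.Re z ^+ 2 + complex.Im z ^+ 2.
Proof. by rewrite sqr_sqrtr// addr_ge0 ?sqr_ge0. Qed.

Lemma mulcJ z : z * z^* = (cmod z ^+ 2)%:C.
Proof. by rewrite sqr_cmod; case: z => a b; apply: eqC => /=; ring. Qed.

Lemma cmod_eq0 z : (cmod z == 0) = (z == 0).
Proof. by rewrite -(normr_eq0 z) cmodE -(inj_eq (@complexI _)). Qed.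

Lemma le_Re_cmod z : `|complex.Re z| <= cmod z.
Proof. by rewrite -sqrtr_sqr ler_wsqrtr// lerDl sqr_ge0. Qed.

Lemma le_Im_cmod z : `|complex.Im z| <= cmod z.
Proof. by rewrite -sqrtr_sqr ler_wsqrtr// lerDr sqr_ge0. Qed.

Lemma le_cmod_ReIm z : cmod z <= `|complex.Re z| + `|complex.Im z|.
Proof.
rewrite -ler_sqr ?nnegrE ?cmod_ge0 ?addr_ge0// sqr_cmod sqrrD !real_normK ?num_real//.
by rewrite addrAC lerDl mulrn_wge0// mulr_ge0.
Qed.

(** * Complex exponential, logarithm and principal powers *)

Definition cexp z : R[i] :=
  (expR (complex.Re z))%:C * (cos (complex.Im z) +i* sin (complex.Im z)).

(** The principal logarithm on the right half-plane. There the argument is an arctangent, which,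
    unlike the arccosine in [Carg], is given by one differentiable formula across the real axis. *)
Definition clog z : R[i] :=
  (ln (complex.Re z ^+ 2 + complex.Im z ^+ 2) / 2) +i*
  atan (complex.Im z / complex.Re z).

Lemma cexpD z w : cexp (z + w) = cexp z * cexp w.
Proof. by apply: eqC; rewrite /= ?ReD ?ImD expRD ?cosD ?sinD; ring. Qed.

Lemma cexp0 : cexp 0 = 1.
Proof. by apply: eqC; rewrite /= expR0 cos0 sin0; ring. Qed.

Lemma cexpN z : cexp (- z) = (cexp z)^-1.
Proof.
have h : cexp (- z) * cexp z = 1 by rewrite -cexpD addNr cexp0.
have z0 : cexp z != 0.
  by apply: contra_eq_neq h => ->; rewrite mulr0 eq_sym oner_neq0.
by apply: (mulIf z0); rewrite h mulVf.
Qed.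

Lemma cmod_cexp z : cmod (cexp z) = expR (complex.Re z).
Proof.
by rewrite cmodM cmod_real ger0_norm ?expR_ge0// /cmod /= cos2Dsin2 sqrtr1 mulr1.
Qed.

Lemma cos_atan_gt0 s : 0 < cos (atan s) :> R.
Proof. by apply: cos_gt0_pihalf; rewrite atan_gtNpi2 atan_ltpi2. Qed.

(** The arctangent has cosine Re z / |z|; the arccosine recovers it up to sign, and the sign is that
    of Im z. *)
Lemma Carg_atan z : 0 < complex.Re z -> Carg z = atan (complex.Im z / complex.Re z).
Proof.
case: z => a b /= a0; rewrite /Carg /cmod /=.
set t := atan (b / a).
have t1 : - (pi / 2) < t < pi / 2 by rewrite atan_gtNpi2 atan_ltpi2.
have -> : a / Num.sqrt (a ^+ 2 + b ^+ 2) = cos t.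
  rewrite cos_atan.
  have -> : 1 + (b / a) ^+ 2 = (a ^+ 2 + b ^+ 2) / a ^+ 2 by field; rewrite gt_eqF.
  rewrite sqrtrM; last by rewrite addr_ge0 ?sqr_ge0.
  by rewrite sqrtrV ?sqr_ge0// sqrtr_sqr gtr0_norm// invfM invrK mulrC.
have pi0 := @pi_gt0 R.
case: ifPn => b0.
  rewrite cosK// in_itv /=; apply/andP; split; last by lra.
  by rewrite -atan0 le_atan// divr_ge0// ltW.
rewrite -cosN cosK ?opprK// in_itv /=; apply/andP; split; last by lra.
rewrite oppr_ge0 -atan0 le_atan// mulr_le0_ge0 ?invr_ge0 ?(ltW a0)//.
by apply/ltW; rewrite ltNge.
Qed.

Lemma cmod_expR z : 0 < complex.Re z ->
  cmod z = expR (ln (complex.Re z ^+ 2 + complex.Im z ^+ 2) / 2).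
Proof.
move=> z0.
have h : 0 < complex.Re z ^+ 2 + complex.Im z ^+ 2.
  by rewrite ltr_pwDl ?sqr_ge0// exprn_gt0.
by rewrite /cmod -powR12_sqrt ?ltW// /powR gt_eqF// mulrC.
Qed.

Lemma cpowE z s : 0 < complex.Re z -> cpow z s = cexp (s%:C * clog z).
Proof.
move=> z0; rewrite /cpow /cexp ReM ImM /= !mul0r subr0 addr0 Carg_atan//.
by rewrite (cmod_expR _ z0) -expRM [_ / 2 * s]mulrC.
Qed.

Lemma cexp_clog z : 0 < complex.Re z -> cexp (clog z) = z.
Proof.
move=> z0; rewrite /cexp /clog /= -(cmod_expR _ z0).
case: z z0 => a b /= a0.
have h : 0 < a ^+ 2 + b ^+ 2 by rewrite ltr_pwDl ?sqr_ge0// exprn_gt0.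
have -> : sin (atan (b / a)) = b / a * cos (atan (b / a)).
  rewrite -{2}(atanK (b / a)) /tan divfK// gt_eqF// cos_atan_gt0//.
have -> : cos (atan (b / a)) = a / cmod (a +i* b).
  rewrite cos_atan.
  have -> : 1 + (b / a) ^+ 2 = (a ^+ 2 + b ^+ 2) / a ^+ 2 by field; rewrite gt_eqF.
  rewrite sqrtrM; last by rewrite ltW.
  by rewrite sqrtrV ?sqr_ge0// sqrtr_sqr gtr0_norm// invfM invrK mulrC.
have c0 : cmod (a +i* b) != 0 by rewrite /cmod /= gt_eqF// sqrtr_gt0.
by apply: eqC => /=; field; rewrite ?c0 ?gt_eqF.
Qed.

Lemma cpowD z s t : 0 < complex.Re z -> cpow z (s + t) = cpow z s * cpow z t.
Proof. by move=> z0; rewrite !cpowE// rmorphD mulrDl cexpD. Qed.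

Lemma cpow_r1 z : 0 < complex.Re z -> cpow z 1 = z.
Proof. by move=> z0; rewrite cpowE// mul1r cexp_clog. Qed.

Lemma cpow_1r s : cpow (1 : R[i]) s = 1.
Proof.
rewrite cpowE//= ?ltr01// /clog /= expr1n expr0n addr0 ln1 !mul0r atan0.
by rewrite -[Complex 0 0]/(0 : R[i]) mulr0 cexp0.
Qed.

Lemma cpowN z s : 0 < complex.Re z -> cpow z (- s) = (cpow z s)^-1.
Proof. by move=> z0; rewrite !cpowE// rmorphN mulNr cexpN. Qed.

Lemma cmod_cpow z s : 0 < complex.Re z -> cmod (cpow z s) = cmod z `^ s.
Proof.
move=> z0; rewrite cpowE// cmod_cexp ReM /= mul0r subr0 (cmod_expR _ z0).
by rewrite -expRM mulrC.
Qed.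

Lemma cpow_real s t : 0 < s -> cpow s%:C t = (s `^ t)%:C.
Proof.
move=> s0; rewrite /cpow Carg_atan//= mul0r atan0 mulr0 cos0 sin0 cmod_real.
by rewrite gtr0_norm// mulr1.
Qed.

(** Half-angle formula: cos s = 1 forces sin (s / 2) = 0, and 0 is the only zero of the sine in
    ]-pi, pi[. *)
Lemma cos_eq1_lt2pi s : `|s| < 2 * pi -> cos s = 1 -> s = 0.
Proof.
move=> s2; rewrite [in cos s](splitr s) cosD.
set h := s / 2 => c1.
have sh : sin h = 0.
  have := cos2Dsin2 h => e; apply/eqP; rewrite -sqrf_eq0; apply/eqP.
  by move: c1 e; rewrite -!expr2; lra.
have sE : s = h *+ 2 by rewrite [LHS]splitr -/h mulr2n.
have : `|h| < pi.
  by move: s2; rewrite sE normrMn mulr2n; lra.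
rewrite ltr_norml => /andP[h1 h2].
have [h0|h0|h0] := ltgtP h 0; last by rewrite sE h0 mul0rn.
- have : 0 < sin (- h) by apply: sin_gt0_pi; apply/andP; split; lra.
  by rewrite sinN sh oppr0 ltxx.
- have : 0 < sin h by apply: sin_gt0_pi; rewrite h0 h2.
  by rewrite sh ltxx.
Qed.

(* All four arguments lie in ]-pi/2, pi/2[, so no multiple of 2 pi appears. *)
Lemma cpow_mul2 z1 z2 z3 z4 s :
  0 < complex.Re z1 -> 0 < complex.Re z2 -> 0 < complex.Re z3 -> 0 < complex.Re z4 ->
  z1 * z2 = z3 * z4 -> cpow z1 s * cpow z2 s = cpow z3 s * cpow z4 s.
Proof.
move=> p1 p2 p3 p4 e; rewrite !cpowE// -!cexpD -!mulrDr; congr (cexp (_ * _)).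
apply/eqP; rewrite -subr_eq0; apply/eqP.
set w := _ - _.
have w1 : cexp w = 1.
  have n3 : cexp (clog z3) != 0.
    by rewrite cexp_clog//; apply: contraTneq p3 => ->; rewrite ltxx.
  have n4 : cexp (clog z4) != 0.
    by rewrite cexp_clog//; apply: contraTneq p4 => ->; rewrite ltxx.
  rewrite /w cexpD cexpN !cexpD !cexp_clog// e divff//.
  by rewrite mulf_neq0//; [move: n3|move: n4]; rewrite cexp_clog.
have aw : `|complex.Im w| < 2 * pi.
  rewrite ImD ImN !ImD /= ltr_norml.
  have := atan_gtNpi2 (complex.Im z1 / complex.Re z1).
  have := atan_gtNpi2 (complex.Im z2 / complex.Re z2).
  have := atan_gtNpi2 (complex.Im z3 / complex.Re z3).
  have := atan_gtNpi2 (complex.Im z4 / complex.Re z4).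
  have := atan_ltpi2 (complex.Im z1 / complex.Re z1).
  have := atan_ltpi2 (complex.Im z2 / complex.Re z2).
  have := atan_ltpi2 (complex.Im z3 / complex.Re z3).
  have := atan_ltpi2 (complex.Im z4 / complex.Re z4).
  by move=> *; apply/andP; split; lra.
have rw : complex.Re w = 0.
  by apply: expR_inj; rewrite -cmod_cexp w1 cmod1 expR0.
have iw : complex.Im w = 0.
  apply: cos_eq1_lt2pi => //.
  have := congr1 (@complex.Re _) w1; rewrite /cexp rw expR0 ReM /=.
  by rewrite mul1r mul0r subr0.
by apply: eqC; rewrite ?rw ?iw.
Qed.

End ComplexPowers.

(** * Derivatives along real paths *)

Section PathDerivative.
Context {R : realType}.
Implicit Types (p q : R -> R[i]) (d e z w : R[i]) (t s : R).

Lemma is_derive_funD (f g : R -> R) t (a b : R) : is_derive t 1 f a ->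
  is_derive t 1 g b -> is_derive t 1 (fun x => f x + g x) (a + b).
Proof. by move=> ? ?; exact: is_deriveD. Qed.

Lemma is_derive_funB (f g : R -> R) t (a b : R) : is_derive t 1 f a ->
  is_derive t 1 g b -> is_derive t 1 (fun x => f x - g x) (a - b).
Proof. by move=> ? ?; exact: is_deriveB. Qed.

Lemma is_derive_funM (f g : R -> R) t (a b : R) : is_derive t 1 f a ->
  is_derive t 1 g b -> is_derive t 1 (fun x => f x * g x) (a * g t + f t * b).
Proof.
move=> hf hg; have := is_deriveM hf hg.
have -> : f t *: b + g t *: a = a * g t + f t * b :> R by rewrite /GRing.scale /=; ring.
by [].
Qed.

Lemma is_derive_funV (f : R -> R) t (a : R) : f t != 0 -> is_derive t 1 f a ->
  is_derive t 1 (fun x => (f x)^-1) (- (a / f t ^+ 2)).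
Proof.
move=> f0 hf; have := is_deriveV f0 hf.
have -> : - f t ^- 2 *: a = - (a / f t ^+ 2) :> R by rewrite /GRing.scale /= mulNr mulrC.
by [].
Qed.

Lemma is_derive_fun_comp (f g : R -> R) t (a b : R) : is_derive (g t) 1 f a ->
  is_derive t 1 g b -> is_derive t 1 (fun x => f (g x)) (a * b).
Proof. by move=> ? ?; exact: is_derive1_comp. Qed.

Lemma is_derive_fun_eq (f : R -> R) t (a b : R) : a = b -> is_derive t 1 f a ->
  is_derive t 1 f b.
Proof. by move=> <-. Qed.

Lemma is_derive_fun_cst t (a : R) : is_derive t 1 (fun=> a : R) (0 : R).
Proof. exact: is_derive_cst. Qed.

(** Componentwise real derivatives, because the paths have a real parameter whereas [derivable] on
    [R[i]] is complex differentiability. *)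
Definition cder p t d : Prop :=
  is_derive t 1 (fun x => complex.Re (p x)) (complex.Re d) /\
  is_derive t 1 (fun x => complex.Im (p x)) (complex.Im d).

Lemma cder_eq p t d e : cder p t d -> d = e -> cder p t e.
Proof. by move=> ? <-. Qed.

Lemma cder_cst z t : cder (fun=> z) t 0.
Proof. by split; apply: is_derive_cst. Qed.

Lemma cderD p q t d e : cder p t d -> cder q t e ->
  cder (fun x => p x + q x) t (d + e).
Proof.
move=> [p1 p2] [q1 q2]; split.
  under eq_fun do rewrite ReD.
  by rewrite ReD; apply: is_deriveD.
under eq_fun do rewrite ImD.
by rewrite ImD; apply: is_deriveD.
Qed.

Lemma cderN p t d : cder p t d -> cder (fun x => - p x) t (- d).
Proof.
move=> [p1 p2]; split.
  under eq_fun do rewrite ReN.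
  by rewrite ReN; apply: is_deriveN.
under eq_fun do rewrite ImN.
by rewrite ImN; apply: is_deriveN.
Qed.

Lemma cderM p q t d e : cder p t d -> cder q t e ->
  cder (fun x => p x * q x) t (d * q t + p t * e).
Proof.
move=> [p1 p2] [q1 q2]; split.
  under eq_fun do rewrite ReM.
  apply: (is_derive_fun_eq _ _ _ _ _ (is_derive_funB _ _ _ _ _
    (is_derive_funM _ _ _ _ _ p1 q1) (is_derive_funM _ _ _ _ _ p2 q2))).
  by rewrite ReD !ReM /GRing.scale /=; ring.
under eq_fun do rewrite ImM.
apply: (is_derive_fun_eq _ _ _ _ _ (is_derive_funD _ _ _ _ _
  (is_derive_funM _ _ _ _ _ p1 q2) (is_derive_funM _ _ _ _ _ p2 q1))).
by rewrite ImD !ImM /GRing.scale /=; ring.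
Qed.

Lemma cderJ p t d : cder p t d -> cder (fun x => (p x)^*) t d^*.
Proof.
move=> [p1 p2]; split.
  under eq_fun do rewrite ReJ.
  by rewrite ReJ.
under eq_fun do rewrite ImJ.
by rewrite ImJ; apply: is_deriveN.
Qed.

Lemma cder_real (f : R -> R) t s : is_derive t 1 f s -> cder (fun x => (f x)%:C) t s%:C.
Proof. by move=> h; split => //=; apply: is_derive_cst. Qed.

Lemma cder_line z w t : cder (fun x => z + x%:C * w) t w.
Proof.
apply: cder_eq.
  by apply: cderD; [apply: cder_cst|apply: cderM; [exact: cder_real|exact: cder_cst]].
by rewrite mulr0 addr0 add0r mul1r.
Qed.

Lemma cder_exp p t d : cder p t d -> cder (fun x => cexp (p x)) t (d * cexp (p t)).
Proof.
move=> [p1 p2]; have cs : cder (fun x => cos (complex.Im (p x)) +i* sin (complex.Im (p x))) t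
    ((- sin (complex.Im (p t)) * complex.Im d) +i* (cos (complex.Im (p t)) * complex.Im d)).
  by split; [exact: (is_derive_fun_comp (@cos R))|exact: (is_derive_fun_comp (@sin R))].
apply: cder_eq.
  apply: cderM cs.
  apply: cder_real; exact: (is_derive_fun_comp expR).
by apply: eqC; rewrite /cexp /= ?ReD ?ImD ?ReM ?ImM /=; ring.
Qed.

Lemma cder_log p t d : 0 < complex.Re (p t) -> cder p t d ->
  cder (fun x => clog (p x)) t (d / p t).
Proof.
move=> p0 [p1 p2].
have h : 0 < complex.Re (p t) ^+ 2 + complex.Im (p t) ^+ 2.
  by rewrite ltr_pwDl ?sqr_ge0// exprn_gt0.
split => /=.
  pose N x := complex.Re (p x) ^+ 2 + complex.Im (p x) ^+ 2.
  have sq : is_derive t 1 N _ := is_derive_funD _ _ _ _ _ (is_derive_funM _ _ _ _ _ p1 p1)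
    (is_derive_funM _ _ _ _ _ p2 p2).
  have ln' := is_derive_fun_comp (@ln R) N _ _ _ (is_derive1_ln h) sq.
  apply: (is_derive_fun_eq _ _ _ _ _ (is_derive_funM _ _ _ _ _ ln'
    (is_derive_fun_cst _ _))).
  rewrite /N mulr0 addr0.
  by case: (p t) d p0 h {p1 p2 sq ln' N} => a b [c e] /= a0 h; field; rewrite gt_eqF.
have n0 : complex.Re (p t) != 0 by rewrite gt_eqF.
apply: (is_derive_fun_eq _ _ _ _ _ (is_derive_fun_comp (@atan R) _ _ _ _
  (is_derive1_atan _)
  (is_derive_funM _ _ _ _ _ p2 (is_derive_funV _ _ _ n0 p1)))).
case: (p t) d p0 h {p1 p2} => a b [c e] /= a0 h; field.
by rewrite !gt_eqF.
Qed.

Lemma cder_cont p t d : cder p t d ->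
  {for t, continuous (fun x => complex.Re (p x))} /\
  {for t, continuous (fun x => complex.Im (p x))}.
Proof.
move=> [p1 p2]; split; apply: differentiable_continuous; apply/derivable1_diffP.
  exact: (@ex_derive _ _ _ _ _ _ _ p1).
exact: (@ex_derive _ _ _ _ _ _ _ p2).
Qed.

Lemma cder_near p q t d : (\forall x \near t, p x = q x) -> cder p t d -> cder q t d.
Proof.
move=> pq [p1 p2]; split.
  apply: near_eq_is_derive p1 => //.
  by near=> x; rewrite (near pq x).
apply: near_eq_is_derive p2 => //.
by near=> x; rewrite (near pq x).
Unshelve. all: by end_near. Qed.

Lemma cder_pow p t d s : 0 < complex.Re (p t) -> cder p t d ->
  cder (fun x => cpow (p x) s) t (s%:C * d * cpow (p t) (s - 1)).
Proof.
move=> p0 hp.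
(* The expression through [cexp] and [clog] is valid only while the real part is positive, hence the
   passage to an equality near [t]. *)
apply: (@cder_near (fun x => cexp (s%:C * clog (p x)))).
  have [c _] := cder_cont _ _ _ hp.
  have : \forall x \near t, 0 < complex.Re (p x).
    by apply: (c [set y : R | 0 < y]); exact: lt_nbhsr.
  by apply: filterS => x px; rewrite cpowE.
apply: cder_eq.
  by apply/cder_exp/cderM; [exact: cder_cst|exact: (cder_log _ _ _ p0 hp)].
rewrite mul0r add0r -cpowE// cpowD// cpowN// cpow_r1//.
by rewrite mulrA mulrAC [RHS]mulrA.
Qed.

Lemma cder0_eq p (u v : R) : u < v ->
  (forall t, u <= t <= v -> cder p t 0) -> p u = p v.
Proof.
move=> uv h.
have c (f : R -> R) : (forall t, u <= t <= v -> is_derive t 1 f 0) -> f u = f v.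
  move=> hf.
  have [t tuv e] : exists2 t, t \in `]u, v[ & f v - f u = 0 * (v - u).
    apply: (@MVT _ f (fun=> 0)) => //.
      by move=> t /[!in_itv]/= /andP[ut tv]; apply: hf; rewrite !ltW.
    apply: derivable_within_continuous => t /[!in_itv]/= /hf ht.
    exact: (@ex_derive _ _ _ _ _ _ _ ht).
  by apply/esym/eqP; rewrite -subr_eq0 e mul0r.
by apply: eqC; apply: (c (fun x => _ (p x))) => t /h [].
Qed.

(* The factor 2 comes from applying the mean value theorem to the real and
   imaginary parts separately. *)
Lemma cmod_cder_le p (d : R -> R[i]) (M : R) :
  (forall t, 0 <= t <= 1 -> cder p t (d t)) ->
  (forall t, 0 <= t <= 1 -> cmod (d t) <= M) ->
  cmod (p 1 - p 0) <= M *+ 2.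
Proof.
move=> h hM.
have c (f g : R -> R) : (forall t, 0 <= t <= 1 -> is_derive t 1 f (g t)) ->
    (forall t, 0 <= t <= 1 -> `|g t| <= M) -> `|f 1 - f 0| <= M.
  move=> hf hg.
  have [t /[!in_itv]/= /andP[t0 t1] e] :
      exists2 t, t \in `]0, 1[ & f 1 - f 0 = g t * (1 - 0).
    apply: (@MVT _ f g) => //.
      by move=> t /[!in_itv]/= /andP[ut tv]; apply: hf; rewrite !ltW.
    apply: derivable_within_continuous => t /[!in_itv]/= /hf ht.
    exact: (@ex_derive _ _ _ _ _ _ _ ht).
  by rewrite e subr0 mulr1 hg// !ltW.
apply: le_trans (le_cmod_ReIm _) _; rewrite mulr2n ReD ReN ImD ImN.
apply: lerD.
  apply: (c (fun x => complex.Re (p x)) (fun x => complex.Re (d x))).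
    by move=> t /h[].
  by move=> t /hM; apply/le_trans/le_Re_cmod.
apply: (c (fun x => complex.Im (p x)) (fun x => complex.Im (d x))).
  by move=> t /h[].
by move=> t /hM; apply/le_trans/le_Im_cmod.
Qed.

(** A quadratic error puts the difference quotient within M |h| of [d]. This is the bridge from
    estimates along real segments to complex differentiability. *)
Lemma derivable_quadratic (F : R[i] -> R[i]) z d (M r : R) : 0 < r ->
  (forall h, cmod h < r -> cmod (F (z + h) - F z - d * h) <= M * cmod h ^+ 2) ->
  derivable (F : R[i]^o -> R[i]^o) z 1.
Proof.
move=> r0 hF; apply/cvg_ex; exists d; apply/cvgrPdist_lt => e e0.
have e1 : 0 < complex.Re e.
  by move: e0; rewrite ltcE => /andP[].
have eE : e = (complex.Re e)%:C.
  by apply: eqC => //=; move: e0; rewrite ltcE => /andP[/eqP].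
(* Below [k] the bound M |h| is smaller than [e]; the summand 1 keeps the denominator positive when
   M = 0. *)
pose k := Num.min r (complex.Re e / (`|M| + 1)).
have k0 : 0 < k by rewrite lt_min r0 divr_gt0// ltr_wpDl.
near=> h.
have hk : cmod h < k.
  rewrite -ltcR -cmodE.
  near: h; apply: dnbhs0_lt.
  by rewrite ltcR.
have h0 : h != 0 by near: h; exact: nbhs_dnbhs_neq.
rewrite /= eE cmodE ltcR -[d](mulfK h0) /GRing.scale /= mulr1 [h^-1 * _]mulrC -mulrBl.
rewrite cmodM cmodV -cmodN opprB [h + z]addrC.
have ch : 0 < cmod h by rewrite lt_neqAle cmod_ge0 eq_sym cmod_eq0 h0.
rewrite ltr_pdivrMr//.
apply: le_lt_trans (hF _ _) _.
  by apply: lt_le_trans hk _; rewrite ge_min lexx.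
rewrite expr2 mulrA ltr_pM2r//.
apply: le_lt_trans (_ : (`|M| + 1) * cmod h < _).
  by rewrite ler_wpM2r ?cmod_ge0// (le_trans (ler_norm M))// lerDl.
rewrite mulrC -ltr_pdivlMr ?ltr_wpDl//.
by apply: lt_le_trans hk _; rewrite ge_min lexx orbT.
Unshelve. all: by end_near. Qed.

End PathDerivative.

(** * The mass of the disk *)

Section Mass.
Context {R : realType}.
Implicit Types (t x y : R).
Notation mu := (@lebesgue_measure R).
Notation RR := (measurableTypeR R * measurableTypeR R)%type.

(** Two-sided derivatives and continuity up to the end points give the one-sided conditions of
    [continuous_FTC2]; the degenerate interval is included. *)
Lemma FTC2_closed (F f : R -> R) (a b : R) : a <= b ->
  (forall x, a <= x <= b -> is_derive x 1 F (f x)) ->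
  (forall x, a <= x <= b -> {for x, continuous f}) ->
  (\int[mu]_(x in `[a, b]) (f x)%:E = (F b - F a)%:E)%E.
Proof.
rewrite le_eqVlt => /predU1P[->|ab] dF cf.
  by rewrite set_itv1 integral_set1 subrr.
have cF x : a <= x <= b -> {for x, continuous F}.
  move=> /dF h; apply: differentiable_continuous; apply/derivable1_diffP.
  exact: (@ex_derive _ _ _ _ _ _ _ h).
rewrite (@continuous_FTC2 _ f F)// ?EFinB//.
- apply/continuous_within_itvP => //; split.
  + by move=> x /[!in_itv]/= /andP[ax xb]; apply: cf; rewrite !ltW.
  + by apply: cvg_at_right_filter; apply: cf; rewrite lexx ltW.
  + by apply: cvg_at_left_filter; apply: cf; rewrite lexx ltW.
- split.
  + move=> x /[!in_itv]/= /andP[ax xb].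
    have h : is_derive x 1 F (f x) by apply: dF; rewrite !ltW.
    exact: (@ex_derive _ _ _ _ _ _ _ h).
  + by apply: cvg_at_right_filter; apply: cF; rewrite lexx ltW.
  + by apply: cvg_at_left_filter; apply: cF; rewrite lexx ltW.
- move=> x /[!in_itv]/= /andP[ax xb].
  have h : is_derive x 1 F (f x) by apply: dF; rewrite !ltW.
  by rewrite derive1E (@derive_val _ _ _ _ _ _ _ h).
Qed.

(** The square is used because the area is carried by it to pi times Lebesgue measure, without the
    Jacobian factor that the modulus would bring in. *)
Definition sqnorm (p : RR) : measurableTypeR R := p.1 ^+ 2 + p.2 ^+ 2.

Lemma measurable_sqnorm : measurable_fun setT sqnorm.
Proof.
by apply: measurable_funD; apply: measurable_funX.
Qed.

Lemma measurable_sqnorm_le t : measurable [set p | sqnorm p <= t].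
Proof.
rewrite (_ : [set _ | _] = sqnorm @^-1` `]-oo, t]); last first.
  by apply/seteqP; split => p /=; rewrite in_itv.
by rewrite -[X in measurable X]setTI; apply: measurable_sqnorm.
Qed.

(** The substitution x = r sin y turns the integrand into 2 t cos(y)^2, the derivative of t (y + sin
    y cos y). *)
Lemma integral_half_circle t : 0 < t ->
  (\int[mu]_(x in `[(- Num.sqrt t)%R, Num.sqrt t]) (2 * Num.sqrt (t - x ^+ 2))%:E
   = (pi * t)%:E)%E.
Proof.
move=> t0; set r := Num.sqrt t.
have r0 : 0 < r by rewrite sqrtr_gt0.
have rt : r ^+ 2 = t by rewrite sqr_sqrtr// ltW.
have pi0 := @pi_gt0 R.
pose F x := r * sin x.
have dF x : is_derive x 1 F (r * cos x).
  apply: (is_derive_fun_eq _ _ _ _ _ (is_derive_funM (fun=> r) _ _ _ _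
     (is_derive_fun_cst _ _) (is_derive_sin x))).
  by rewrite mul0r add0r.
have cF : continuous F.
  move=> x; apply: differentiable_continuous; apply/derivable1_diffP.
  exact: (@ex_derive _ _ _ _ _ _ _ (dF x)).
have F' : derive1 F = fun x => r * cos x.
  by apply/funext => x; rewrite derive1E (@derive_val _ _ _ _ _ _ _ (dF x)).
have cF' : continuous (fun x => r * cos x).
  by move=> x; apply: cvgM; [exact: cvg_cst|exact: continuous_cos].
have -> : - r = F (- (pi / 2)) by rewrite /F sinN sin_pihalf mulrN1.
have -> : r = F (pi / 2) by rewrite /F sin_pihalf mulr1.
rewrite (@integration_by_substitution_increasing _ F
  (fun x => 2 * Num.sqrt (t - x ^+ 2))).
- rewrite F'.
  transitivity (\int[mu]_(x in `[(- (pi / 2))%R, (pi / 2)%R])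
      (t * (2 * cos x ^+ 2))%:E)%E.
    apply: eq_integral => x; rewrite inE /= in_itv /= => xI.
    congr EFin.
    rewrite -[LHS]/(2 * Num.sqrt (t - (r * sin x) ^+ 2) * (r * cos x)) exprMn rt.
    have -> : t - t * sin x ^+ 2 = t * cos x ^+ 2 by rewrite cos2sin2; ring.
    rewrite sqrtrM ?(ltW t0)// sqrtr_sqr ger0_norm; last exact: cos_ge0_pihalf.
    by rewrite -/r -rt; ring.
  have dG x : is_derive x 1 (fun x => t * (x + sin x * cos x)) (t * (2 * cos x ^+ 2)).
    apply: (is_derive_fun_eq _ _ _ _ _ (is_derive_funM (fun=> t) _ _ _ _
     (is_derive_fun_cst _ _) (is_derive_funD _ _ _ _ _ (is_derive_id _ _)
       (is_derive_funM _ _ _ _ _ (is_derive_sin x) (is_derive_cos x))))).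
    by rewrite mul0r add0r mulrN -!expr2 sin2cos2; ring.
  rewrite (FTC2_closed _ _ _ _ _ (fun x _ => dG x)).
  + by rewrite sinN cosN cos_pihalf; congr EFin; field.
  + by lra.
  + move=> x _; apply: cvgM; first exact: cvg_cst.
    apply: cvgM; first exact: cvg_cst.
    by rewrite expr2; apply: cvgM; exact: continuous_cos.
- by lra.
- move=> x y xI yI xy; rewrite /F ltr_pM2l// ltr_sin//.
- by move=> x _; rewrite F'; exact: cF'.
- by rewrite F'; apply/cvg_ex; exists (r * cos (- (pi / 2))); apply: cvg_at_right_filter; exact: cF'.
- by rewrite F'; apply/cvg_ex; exists (r * cos (pi / 2)); apply: cvg_at_left_filter; exact: cF'.
- split.
  + by move=> x _; exact: (@ex_derive _ _ _ _ _ _ _ (dF x)).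
  + by apply: cvg_at_right_filter; exact: cF.
  + by apply: cvg_at_left_filter; exact: cF.
- apply: continuous_subspaceT => x.
  apply: cvgM; first exact: cvg_cst.
  apply: (@continuous_comp _ _ _ (fun x => t - x ^+ 2) (@Num.sqrt R)).
    by apply: cvgB; [exact: cvg_cst|exact: exprn_continuous].
  exact: sqrt_continuous.
Qed.

(** The area is integrated over vertical sections, which are intervals of half-length sqrt (t -
    x^2). As [Num.sqrt] is 0 on negative numbers, the same formula covers empty sections. *)
Lemma area_sqnorm_le t : area R [set p | sqnorm p <= t] = (pi * Num.max t 0)%:E.
Proof.
rewrite /area /= /product_measure1.
have sec x : mu (xsection [set p | sqnorm p <= t] x) = (2 * Num.sqrt (t - x ^+ 2))%:E.
  have [tx|tx] := ltP (t - x ^+ 2) 0.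
    rewrite (_ : xsection _ _ = set0) ?measure0.
      by rewrite ltr0_sqrtr// mulr0.
    apply/seteqP; split => y //=; rewrite /xsection /= inE /= /sqnorm /= => h.
    by have := sqr_ge0 y; lra.
  rewrite (_ : xsection _ _ = `[- Num.sqrt (t - x ^+ 2), Num.sqrt (t - x ^+ 2)]%classic).
    rewrite lebesgue_measure_itv /= lte_fin.
    have := sqrtr_ge0 (t - x ^+ 2); set s := Num.sqrt _ => s0.
    case: ifPn => [_|]; first by rewrite -EFinB; congr EFin; ring.
    rewrite -leNgt => h; have -> : s = 0 by lra.
    by rewrite mulr0.
  apply/seteqP; split => y; rewrite /xsection /= inE /= /sqnorm /= in_itv /= -ler_norml => h.
    by rewrite -sqrtr_sqr ler_wsqrtr//; lra.
  have : `|y| ^+ 2 <= Num.sqrt (t - x ^+ 2) ^+ 2.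
    by rewrite ler_sqr ?nnegrE ?sqrtr_ge0.
  by rewrite real_normK ?num_real// sqr_sqrtr//; lra.
under eq_integral do rewrite /= sec.
have [t0|t0] := leP t 0.
  rewrite mulr0 integral0_eq// => x _.
  by rewrite ler0_sqrtr ?mulr0//; have := sqr_ge0 x; lra.
rewrite -integral_half_circle//.
rewrite [RHS]integral_mkcond; apply: eq_integral => x _.
rewrite patchE; case: ifPn => //; rewrite notin_setE /= in_itv /= -ler_norml => h.
rewrite ler0_sqrtr ?mulr0// subr_le0.
move/negP: h; rewrite -ltNge => h.
rewrite -[x ^+ 2]real_normK ?num_real// -(@sqr_sqrtr _ t) ?(ltW t0)//.
by rewrite ler_sqr ?nnegrE ?sqrtr_ge0// ltW.
Qed.

End Mass.

(** * Image of the area under the squared modulus, and total mass of dA_gamma *)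

Section MassOne.
Context {R : realType}.
Implicit Types (t x y : R).
Notation mu := (@lebesgue_measure R).
Notation RR := (measurableTypeR R * measurableTypeR R)%type.

Lemma area_annulus (a b : R) : a <= b ->
  area R [set p | a < sqnorm p <= b] = (pi * (Num.max b 0 - Num.max a 0))%:E.
Proof.
move=> ab.
have -> : [set p : RR | a < sqnorm p <= b] =
    [set p | sqnorm p <= b] `\` [set p | sqnorm p <= a].
  apply/seteqP; split => p /=.
    by move=> /andP[h ->]; split=> //; apply/negP; rewrite -ltNge.
  by move=> [-> /negP]; rewrite -ltNge => ->.
rewrite measureD; [|exact: measurable_sqnorm_le|exact: measurable_sqnorm_le|].
  rewrite (_ : _ `&` _ = [set p | sqnorm p <= a]); last first.
    by apply/setIidr => p /= /le_trans; apply.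
  rewrite mulrBr EFinB.
  exact: (congr2 (fun u v => u - v)%E (area_sqnorm_le b) (area_sqnorm_le a)).
by apply: le_lt_trans (ltry (pi * Num.max b 0)); rewrite -area_sqnorm_le.
Qed.

Let nu : {measure set (measurableTypeR R) -> \bar R}.
Proof. by refine (pushforward (area R) sqnorm); exact: measurable_sqnorm. Defined.

Let pi_inv : {nonneg R} := NngNum (ltW (eqbRL (invr_gt0 (pi : R)) (pi_gt0 R))).

(** Uniqueness of Lebesgue measure requires agreement on all intervals of the line, but the image
    measure gives no mass to negative numbers. The measure [m] therefore adds Lebesgue measure on
    the negative half-line to the image divided by pi; on [A] the added part vanishes. *)
Lemma pushforward_area (A : set (measurableTypeR R)) : measurable A -> A `<=` `[0, 1[ ->
  pushforward (area R) sqnorm A = (pi%:E * mu A)%E.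
Proof.
move=> mA A01.
pose m1 : {measure set (measurableTypeR R) -> \bar R} := mscale pi_inv nu.
have mN : measurable (`]-oo, 0[%classic : set (measurableTypeR R)) by [].
pose m2 : {measure set (measurableTypeR R) -> \bar R} := mrestr mu mN.
pose m : {measure set (measurableTypeR R) -> \bar R} := measure_add m1 m2.
have mE X : m X = ((pi^-1)%:E * nu X + mu (X `&` `]-oo, 0%R[))%E by exact: measure_addE.
have nuE (a b : R) : a <= b ->
    nu `]a, b]%classic = (pi * (Num.max b 0 - Num.max a 0))%:E.
  by move=> ab; rewrite -area_annulus.
have pi0 : (pi : R) != 0 by rewrite gt_eqF// pi_gt0.
have e : mu A = m A.
  apply: lebesgue_measure_unique => // X /ocitvP[->|[[a b] /= ab ->]].
    by rewrite !measure0.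
  rewrite mE nuE ?(ltW ab)// -EFinM mulKf//.
  rewrite lebesgue_measure_itv /= lte_fin ab.
  have [b0|b0] := ltP b 0.
    have a0 : a < 0 by lra.
    rewrite (_ : _ `&` _ = `]a, b]%classic); last first.
      by apply/setIidl => x /=; rewrite !in_itv /= => /andP[_ xb]; lra.
    rewrite lebesgue_measure_itv /= lte_fin ab.
    by rewrite (max_r (ltW a0)) subrr add0e.
  have [a0|a0] := ltP a 0.
    rewrite (_ : _ `&` _ = `]a, 0[%classic); last first.
      apply/seteqP; split => x /=; rewrite !in_itv /= => h; first by lra.
      by split; lra.
    rewrite lebesgue_measure_itv /= lte_fin a0 -!EFinB -EFinD; congr EFin; ring.
  rewrite (_ : _ `&` _ = set0).
    by rewrite measure0 adde0.
  by apply/seteqP; split => x //=; rewrite !in_itv /=; lra.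
rewrite e mE.
rewrite (_ : A `&` _ = set0); last first.
  apply/seteqP; split => x //= [/A01]; rewrite /= !in_itv /=; lra.
by rewrite measure0 adde0 muleA -EFinM mulfV// mul1e.
Qed.

Lemma sqr_cmod_pair (p : RR) : cmod (p.1 +i* p.2) ^+ 2 = sqnorm p.
Proof. by rewrite sqr_cmod. Qed.

Lemma planar_diskE : @planar_disk R = sqnorm @^-1` `[0, 1[.
Proof.
apply/seteqP; split => p; rewrite /planar_disk /disk /= in_itv /= -sqr_cmod_pair.
  by move=> h; rewrite sqr_ge0 /= expr_lt1 ?cmod_ge0.
by rewrite sqr_ge0 /= expr_lt1 ?cmod_ge0.
Qed.

Lemma measurable_planar_disk : measurable (@planar_disk R : set RR).
Proof.
rewrite planar_diskE -[X in measurable X]setTI.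
by apply: measurable_sqnorm.
Qed.

(** For g < 0 the integrand blows up at 1, so the fundamental theorem is applied on [0, 1 - 1/(n+2)]
    and followed by monotone convergence. The boundary term tends to 0 because g + 1 > 0. *)
Lemma integral_powR_onem (g : R) : -1 < g ->
  (\int[mu]_(x in `[0%R, 1%R[) ((1 - x) `^ g)%:E = ((g + 1)^-1)%:E)%E.
Proof.
move=> g1.
have mpow : measurable_fun setT (fun x : R => (1 - x) `^ g).
  apply: (measurableT_comp (measurable_powR g)).
  by apply: measurable_funB.
pose F n := `[0%R, 1 - n.+2%:R^-1]%classic : set (measurableTypeR R).
have -> : `[0%R, 1%R[%classic = \bigcup_n F n.
  apply/seteqP; split => x /=.
    rewrite in_itv /= => /andP[x0 x1].
    have [n hn] := @ltr_add_invr R x 1 x1.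
    exists n => //; rewrite /F /= in_itv /= x0 /=.
    have : n.+2%:R^-1 <= n.+1%:R^-1 :> R by rewrite lef_pV2 ?posrE// ler_nat.
    move: hn; set u := _^-1; set v := _^-1; lra.
  move=> [n _]; rewrite /F /= !in_itv /= => /andP[-> xn] /=.
  by apply: le_lt_trans xn _; rewrite ltrBlDr ltrDl invr_gt0.
have ndF : nondecreasing_seq F.
  apply/nondecreasing_seqP => n; rewrite subsetEset /F => x /=; rewrite !in_itv /=.
  move=> /andP[-> /le_trans -> //]; rewrite lerD2l lerN2 lef_pV2 ?posrE//.
  by rewrite ler_nat.
have mF n : measurable (F n) by exact: measurable_itv.
have mf n : measurable_fun (F n) (fun x => ((1 - x) `^ g)%:E).
  by apply/measurable_EFinP; apply: measurable_funS mpow.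
have f0 n x : F n x -> (0 <= ((1 - x) `^ g)%:E)%E.
  by move=> _; rewrite lee_fin powR_ge0.
have /cvg_lim <- // := @ge0_nondecreasing_set_cvg_integral _ _ _ _ _ mu ndF mF mf f0.
have g0 : 0 < g + 1 by lra.
have iE n : (\int[mu]_(x in F n) ((1 - x) `^ g)%:E =
    ((g + 1)^-1 * (1 - n.+2%:R^-1 `^ (g + 1)))%:E)%E.
  have n0 : 0 < n.+2%:R^-1 :> R by rewrite invr_gt0.
  have n1 : n.+2%:R^-1 <= 1 :> R by rewrite invf_le1// ler1n.
  rewrite /F; move: (n.+2%:R^-1 : R) n0 n1 => k n0 n1.
  have dG (x : R) : 0 <= x <= 1 - k ->
      is_derive x 1 (fun x => - (g + 1)^-1 * (1 - x) `^ (g + 1)) ((1 - x) `^ g).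
    move=> /andP[x0 x1].
    have px : 0 < 1 - x by lra.
    have d1 := is_derive_funB _ _ x _ _ (is_derive_fun_cst x 1) (is_derive_id x 1).
    have d2 := is_derive_fun_comp (fun x => x `^ (g + 1)) _ x _ _ (is_derive1_powR (g + 1) px) d1.
    apply: (is_derive_fun_eq _ _ _ _ _ (is_derive_funM _ _ _ _ _
      (is_derive_fun_cst x (- (g + 1)^-1)) d2)).
    by rewrite addrK; field; lra.
  rewrite (FTC2_closed _ _ _ _ _ dG).
  - by rewrite subKr subr0 powR1; congr EFin; ring.
  - lra.
  - move=> x /andP[x0 x1].
    apply: (@continuous_comp _ _ _ (fun x => 1 - x) (fun x => x `^ g)).
      by apply: cvgB; [exact: cvg_cst|exact: cvg_id].
    apply: differentiable_continuous; apply/derivable1_diffP.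
    by apply: derivable_powR; rewrite in_itv /= andbT; lra.
under eq_fun do rewrite iE.
have lim0 : (n.+2%:R^-1 : R) `^ (g + 1) @[n --> \oo] --> (0 : R).
  have /cvg_at_rightP := @powR_cvg0 R (g + 1) g0; apply.
  split; first by move=> n; rewrite invr_gt0.
  by have := @cvg_harmonic R; rewrite -cvg_shiftS.
have lim1 : (g + 1)^-1 * (1 - n.+2%:R^-1 `^ (g + 1)) @[n --> \oo] --> ((g + 1)^-1 * (1 - 0) : R).
  by apply: cvgM; [exact: cvg_cst|apply: cvgB; [exact: cvg_cst|]].
rewrite subr0 mulr1 in lim1.
by apply: cvg_lim => //; apply: cvg_EFin lim1; exact: nearW.
Qed.

Lemma density_ge0 (g : R) (z : R[i]) : -1 < g -> 0 <= density g z.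
Proof.
move=> g1; rewrite /density mulr_ge0 ?powR_ge0// divr_ge0 ?pi_ge0//; lra.
Qed.

(** The density depends on the squared modulus only, so the integral is one-dimensional after
    pushing forward; the resulting factors pi and 1 / (g + 1) cancel the normalization. *)
Lemma integral_density (g : R) : -1 < g ->
  (\int[area R]_(p in @planar_disk R) (density g (p.1 +i* p.2))%:E = 1)%E.
Proof.
move=> g1; have g0 : 0 < g + 1 by lra.
pose f (t : measurableTypeR R) : R := (g + 1) / pi * (1 - t) `^ g.
have mf : measurable_fun setT f.
  apply: measurable_funM => //.
  apply: (measurableT_comp (measurable_powR g)).
  by apply: measurable_funB.
have f0 t : 0 <= f t by rewrite mulr_ge0 ?powR_ge0// divr_ge0 ?pi_ge0//; lra.
have mf1 : measurable_fun (`[0, 1[%classic : set (measurableTypeR R)) (fun t => (f t)%:E).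
  by apply/measurable_EFinP; apply: measurable_funS mf.
transitivity (\int[nu]_(t in `[0%R, 1%R[) (f t)%:E)%E.
  apply/esym; apply: etrans (ge0_integral_pushforward measurable_sqnorm (area R)
    (measurable_itv _) mf1 (fun t _ => f0 t)) _.
  rewrite planar_diskE; apply: eq_integral => p _.
  by rewrite /density sqr_cmod_pair.
pose ppi : {nonneg R} := NngNum (ltW (pi_gt0 R)).
transitivity (\int[mscale ppi mu]_(t in `[0%R, 1%R[) (f t)%:E)%E.
  by apply: eq_measure_integral => A mA sA; exact: pushforward_area.
transitivity (pi%:E * \int[mu]_(t in `[0%R, 1%R[) (f t)%:E)%E.
  exact: (ge0_integral_mscale mu (measurable_itv _) ppi mf1 (fun t _ => f0 t)).
under eq_integral do rewrite /f EFinM.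
rewrite ge0_integralZl_EFin//; last 3 first.
- by move=> t _; rewrite lee_fin powR_ge0.
- apply/measurable_EFinP; apply: measurable_funTS.
  apply: (measurableT_comp (measurable_powR g)).
  by apply: measurable_funB.
- by rewrite divr_ge0 ?pi_ge0//; lra.
rewrite integral_powR_onem// -!EFinM; congr EFin.
move: (pi : R) (@pi_gt0 R) => p p0.
by field; rewrite (gt_eqF g0) (gt_eqF p0).
Qed.

End MassOne.

(** * Integrals of bounded functions over the disk *)

Section BoundedMeasurable.
Context {R : realType}.
Implicit Types (t x y g s : R) (z w a : R[i]).
Notation RR := (measurableTypeR R * measurableTypeR R)%type.
Notation D := (@planar_disk R : set RR).
Implicit Types (f h : RR -> R) (F H : R[i] -> R[i]).

(** Boundedness, unlike integrability, is stable under products, and it suffices for integrability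
    against the density for every g > -1. *)
Definition bmeas f := measurable_fun D f /\ exists M : R, forall p, D p -> `|f p| <= M.

Lemma bmeas_ext f h : (forall p, D p -> f p = h p) -> bmeas f -> bmeas h.
Proof.
move=> fh [mf [M hM]]; split.
  by apply: eq_measurable_fun mf => p /[!inE] /fh.
by exists M => p Dp; rewrite -fh// hM.
Qed.

Lemma bmeas_cst s : bmeas (fun=> s).
Proof. by split; [exact: measurable_cst|exists `|s|]. Qed.

Lemma bmeasD f h : bmeas f -> bmeas h -> bmeas (fun p => f p + h p).
Proof.
move=> [mf [M hM]] [mh [N hN]]; split; first exact: measurable_funD.
by exists (M + N) => p Dp; rewrite (le_trans (ler_normD _ _))// lerD ?hM ?hN.
Qed.

Lemma bmeasM f h : bmeas f -> bmeas h -> bmeas (fun p => f p * h p).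
Proof.
move=> [mf [M hM]] [mh [N hN]]; split; first exact: measurable_funM.
by exists (M * N) => p Dp; rewrite normrM ler_pM ?hM ?hN.
Qed.

Lemma bmeasN f : bmeas f -> bmeas (fun p => - f p).
Proof.
move=> hf; apply: (bmeas_ext (fun p => -1 * f p)); first by move=> p _; rewrite mulN1r.
exact: bmeasM (bmeas_cst _) hf.
Qed.

Lemma bmeasB f h : bmeas f -> bmeas h -> bmeas (fun p => f p - h p).
Proof. by move=> hf hh; apply: bmeasD hf (bmeasN _ hh). Qed.

Definition cbmeas F :=
  bmeas (fun p => complex.Re (F (p.1 +i* p.2))) /\
  bmeas (fun p => complex.Im (F (p.1 +i* p.2))).

Lemma cbmeas_ext F H : (forall z, disk z -> F z = H z) -> cbmeas F -> cbmeas H.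
Proof.
by move=> FH [F1 F2]; split; [apply: bmeas_ext F1|apply: bmeas_ext F2] => p /FH ->.
Qed.

Lemma cbmeas_cst z : cbmeas (fun=> z).
Proof. by split; exact: bmeas_cst. Qed.

Lemma cbmeasD F H : cbmeas F -> cbmeas H -> cbmeas (fun z => F z + H z).
Proof.
move=> [F1 F2] [H1 H2]; split.
  by apply: bmeas_ext (bmeasD _ _ F1 H1) => p _; rewrite ReD.
by apply: bmeas_ext (bmeasD _ _ F2 H2) => p _; rewrite ImD.
Qed.

Lemma cbmeasM F H : cbmeas F -> cbmeas H -> cbmeas (fun z => F z * H z).
Proof.
move=> [F1 F2] [H1 H2]; split.
  by apply: bmeas_ext (bmeasB _ _ (bmeasM _ _ F1 H1) (bmeasM _ _ F2 H2)) => p _; rewrite ReM.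
by apply: bmeas_ext (bmeasD _ _ (bmeasM _ _ F1 H2) (bmeasM _ _ F2 H1)) => p _; rewrite ImM.
Qed.

Lemma cbmeasJ F : cbmeas F -> cbmeas (fun z => (F z)^*).
Proof.
move=> [F1 F2]; split.
  by apply: bmeas_ext F1 => p _; rewrite ReJ.
by apply: bmeas_ext (bmeasN _ F2) => p _; rewrite ImJ.
Qed.

Lemma cbmeasN F : cbmeas F -> cbmeas (fun z => - F z).
Proof.
move=> hF; apply: (cbmeas_ext (fun z => -1 * F z)); first by move=> z _; rewrite mulN1r.
exact: cbmeasM (cbmeas_cst _) hF.
Qed.

Lemma cbmeasB F H : cbmeas F -> cbmeas H -> cbmeas (fun z => F z - H z).
Proof. by move=> hF hH; apply: cbmeasD hF (cbmeasN _ hH). Qed.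

Lemma cbmeas_id : cbmeas id.
Proof.
split; split.
- by apply: measurable_funTS; exact: measurable_fst.
- exists 1 => p Dp.
  by apply/(le_trans (le_Re_cmod (p.1 +i* p.2)))/ltW.
- by apply: measurable_funTS; exact: measurable_snd.
- exists 1 => p Dp.
  by apply/(le_trans (le_Im_cmod (p.1 +i* p.2)))/ltW.
Qed.

Lemma cbmeas_Re F : cbmeas F -> cbmeas (fun z => (complex.Re (F z))%:C).
Proof. by move=> [F1 F2]; split => //=; exact: bmeas_cst. Qed.

(** A power is monotone in its base, in a direction given by the sign of [s]; the sum of the two end
    values serves both directions. *)
Lemma powR_le_bounds (c C x s : R) : 0 < c -> c <= x -> x <= C -> x `^ s <= c `^ s + C `^ s.
Proof.
move=> c0 cx xC.
have x0 := lt_le_trans c0 cx; have C0 := lt_le_trans x0 xC.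
have [s0|s0] := leP 0 s.
  apply: le_trans (_ : C `^ s <= _); last by rewrite lerDr powR_ge0.
  by rewrite ge0_ler_powR// nnegrE ltW.
apply: le_trans (_ : c `^ s <= _); last by rewrite lerDl powR_ge0.
have e (y : R) : y `^ s = (y `^ (- s))^-1 by rewrite powRN invrK.
rewrite !e lef_pV2 ?posrE ?powR_gt0//.
by apply: ge0_ler_powR; rewrite ?nnegrE; lra.
Qed.

Lemma cmod_mulJ_lt1 a z : disk a -> disk z -> cmod (a^* * z) < 1.
Proof.
rewrite /disk /= => ha hz; rewrite cmodM cmodJ.
have [a0|a0] := leP (cmod a) 0.
  have -> : cmod a = 0 by apply/eqP; rewrite eq_le a0 cmod_ge0.
  by rewrite mul0r.
apply: lt_le_trans (_ : cmod a * 1 <= _); first by rewrite ltr_pM2l.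
by rewrite mulr1 ltW.
Qed.

(** This places the base of every kernel in the half-plane where the principal powers are smooth. *)
Lemma Re_kernel_gt0 a z : disk a -> disk z -> 0 < complex.Re (1 - a^* * z).
Proof.
move=> ha hz; rewrite ReD ReN subr_gt0.
apply: le_lt_trans (cmod_mulJ_lt1 a z ha hz).
by apply: le_trans (le_Re_cmod _); exact: ler_norm.
Qed.

Lemma cmod_kernel_bounds a z : disk z -> 1 - cmod a <= cmod (1 - a^* * z) <= 1 + cmod a.
Proof.
rewrite /disk /= => hz.
have h : cmod (a^* * z) <= cmod a.
  by rewrite cmodM cmodJ ler_piMr ?cmod_ge0// ltW.
apply/andP; split.
  have := le_cmodD (1 - a^* * z) (a^* * z); rewrite subrK cmod1; lra.
by apply: le_trans (le_cmodD _ _) _; rewrite cmod1 cmodN lerD2l.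
Qed.

(** Uniformity over the parameters of modulus at most [r] is what later dominates the derivative
    with respect to the parameter. *)
Lemma cpow_kernel_bounded (r s : R) : r < 1 -> exists M : R,
  forall a z, cmod a <= r -> disk z -> cmod (cpow (1 - a^* * z) s) <= M.
Proof.
move=> r1; exists ((1 - r) `^ s + 2 `^ s) => a z ar hz.
have ha : disk a by apply: le_lt_trans r1.
rewrite cmod_cpow ?Re_kernel_gt0//.
have /andP[h1 h2] := cmod_kernel_bounds a z hz.
by apply: powR_le_bounds; lra.
Qed.

Lemma cbmeas_kernel a s : disk a -> cbmeas (fun z => cpow (1 - a^* * z) s).
Proof.
move=> ha.
pose P z := 1 - a^* * z.
have [[mu _] [mv _]] : cbmeas P.
  by apply: cbmeasB (cbmeas_cst _) (cbmeasM _ _ (cbmeas_cst _) cbmeas_id).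
have P0 (p : RR) : D p -> 0 < complex.Re (P (p.1 +i* p.2)).
  by move=> Dp; exact: Re_kernel_gt0.
pose L (p : RR) := ln (complex.Re (P (p.1 +i* p.2)) ^+ 2 + complex.Im (P (p.1 +i* p.2)) ^+ 2) / 2.
(* The inverse is written as a power of exponent -1, which is measurable on the whole line and
   agrees with the inverse on positive numbers. *)
pose T (p : RR) := atan (complex.Im (P (p.1 +i* p.2)) * complex.Re (P (p.1 +i* p.2)) `^ (-1)).
have mL : measurable_fun D L.
  apply: measurable_funM => //; apply: (measurableT_comp (@measurable_ln R)).
  by apply: measurable_funD; exact: measurable_funX.
have mT : measurable_fun D T.
  apply: (measurableT_comp (f := @atan R)).
    by apply: continuous_measurable_fun; exact: continuous_atan.
  apply: measurable_funM => //.
  exact: (measurableT_comp (measurable_powR (-1))).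
have mE : measurable_fun D (fun p => expR (s * L p)).
  by apply: (measurableT_comp (@measurable_expR R)); exact: measurable_funM.
have mC : measurable_fun D (fun p => cos (s * T p)).
  apply: (measurableT_comp (f := @cos R)); last exact: measurable_funM.
  by apply: continuous_measurable_fun; exact: continuous_cos.
have mS : measurable_fun D (fun p => sin (s * T p)).
  apply: (measurableT_comp (f := @sin R)); last exact: measurable_funM.
  by apply: continuous_measurable_fun; exact: continuous_sin.
have E (p : RR) : D p ->
    cpow (P (p.1 +i* p.2)) s = (expR (s * L p))%:C * (cos (s * T p) +i* sin (s * T p)).
  move=> Dp; rewrite cpowE ?P0// /cexp ReM ImM /= !mul0r subr0 addr0.
  by rewrite /T powR_inv1 ?ltW ?P0.
have [M hM] := cpow_kernel_bounded (cmod a) s ha.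
split; split.
- apply: (eq_measurable_fun (fun p => expR (s * L p) * cos (s * T p))).
    by move=> p /[!inE] Dp; rewrite E// ReM /= mul0r subr0.
  exact: measurable_funM.
- exists M => p Dp; apply: le_trans (le_Re_cmod _) _; exact: hM.
- apply: (eq_measurable_fun (fun p => expR (s * L p) * sin (s * T p))).
    by move=> p /[!inE] Dp; rewrite E// ImM /= mul0r addr0.
  exact: measurable_funM.
- exists M => p Dp; apply: le_trans (le_Im_cmod _) _; exact: hM.
Qed.

End BoundedMeasurable.

(** * Linearity and conjugation of the integral against dA_gamma *)

Section DiskIntegral.
Context {R : realType}.
Variable g : R.
Hypothesis g1 : -1 < g.
Notation RR := (measurableTypeR R * measurableTypeR R)%type.
Notation D := (@planar_disk R : set RR).
Implicit Types (f h : RR -> R) (F H : R[i] -> R[i]).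
Let W (p : RR) : R := density g (p.1 +i* p.2).

Lemma measurable_density : measurable_fun D W.
Proof.
apply: measurable_funTS.
rewrite (_ : W = fun p => (g + 1) / pi * (1 - sqnorm p) `^ g); last first.
  by apply/funext => p; rewrite /W /density sqr_cmod_pair.
apply: measurable_funM => //.
apply: (measurableT_comp (measurable_powR g)).
by apply: measurable_funB => //; exact: measurable_sqnorm.
Qed.

Lemma integrable_density : (area R).-integrable D (EFin \o W).
Proof.
apply/integrableP; split; first by apply/measurable_EFinP; exact: measurable_density.
under eq_integral do rewrite /= ger0_norm ?density_ge0//.
by rewrite integral_density// ltry.
Qed.

Lemma bmeas_integrable f : bmeas f -> (area R).-integrable D (EFin \o (fun p => f p * W p)).
Proof.
move=> [mf [M hM]].
apply: (@le_integrable _ _ _ _ _ _ _ (EFin \o (fun p => M * W p))).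
- exact: measurable_planar_disk.
- by apply/measurable_EFinP; apply: measurable_funM mf measurable_density.
- move=> p Dp /=; rewrite lee_fin !normrM ler_wpM2r//.
  by apply: le_trans (hM _ Dp) (ler_norm _).
- rewrite (_ : _ \o _ = fun p => M%:E * (EFin \o W) p)%E; last first.
    by apply/funext => p /=; rewrite EFinM.
  by apply: integrableZl; [exact: measurable_planar_disk|exact: integrable_density].
Qed.

Definition dint f : R := (\int[area R]_(p in D) (f p * W p))%R.

Lemma dint_ext f h : (forall p, D p -> f p = h p) -> dint f = dint h.
Proof. by move=> fh; apply: eq_Rintegral => p /[!inE] /fh ->. Qed.

Lemma dintD f h : bmeas f -> bmeas h -> dint (fun p => f p + h p) = dint f + dint h.
Proof.
move=> hf hh; rewrite /dint -RintegralD; last 3 first.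
- exact: measurable_planar_disk.
- exact: bmeas_integrable.
- exact: bmeas_integrable.
by apply: eq_Rintegral => p _; rewrite mulrDl.
Qed.

Lemma dintZ (c : R) f : bmeas f -> dint (fun p => c * f p) = c * dint f.
Proof.
move=> hf; rewrite /dint -RintegralZl; last 2 first.
- exact: measurable_planar_disk.
- exact: bmeas_integrable.
by apply: eq_Rintegral => p _; rewrite mulrA.
Qed.

Lemma dintN f : bmeas f -> dint (fun p => - f p) = - dint f.
Proof.
move=> hf; rewrite -mulN1r -dintZ//; apply: dint_ext => p _; by rewrite mulN1r.
Qed.

Lemma dint1 : dint (fun=> 1) = 1.
Proof.
rewrite /dint /Rintegral; under eq_integral do rewrite mul1r.
by rewrite integral_density.
Qed.

Lemma disk_integralE F : disk_integral g F =
  dint (fun p => complex.Re (F (p.1 +i* p.2))) +i*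
  dint (fun p => complex.Im (F (p.1 +i* p.2))).
Proof. by []. Qed.

Lemma disk_integral_ext F H : (forall z, disk z -> F z = H z) ->
  disk_integral g F = disk_integral g H.
Proof.
by move=> FH; rewrite !disk_integralE; congr (_ +i* _); apply: dint_ext => p /FH ->.
Qed.

Lemma disk_integralD F H : cbmeas F -> cbmeas H ->
  disk_integral g (fun z => F z + H z) = disk_integral g F + disk_integral g H.
Proof.
move=> [F1 F2] [H1 H2]; rewrite !disk_integralE.
by apply: eqC; rewrite ?ReD ?ImD /= -dintD//; apply: dint_ext => p _; rewrite ?ReD ?ImD.
Qed.

Lemma disk_integralZ (c : R[i]) F : cbmeas F ->
  disk_integral g (fun z => c * F z) = c * disk_integral g F.
Proof.
move=> [F1 F2]; rewrite !disk_integralE; apply: eqC; rewrite ?ReM ?ImM /=.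
  rewrite -!dintZ// -dintN; last exact: bmeasM (bmeas_cst _) _.
  rewrite -dintD//; [|exact: bmeasM (bmeas_cst _) _|].
    by apply: dint_ext => p _; rewrite ReM.
  by apply/bmeasN/bmeasM => //; exact: bmeas_cst.
rewrite -!dintZ// -dintD//; [|exact: bmeasM (bmeas_cst _) _|exact: bmeasM (bmeas_cst _) _].
by apply: dint_ext => p _; rewrite ImM.
Qed.

Lemma disk_integralJ F : cbmeas F ->
  disk_integral g (fun z => (F z)^*) = (disk_integral g F)^*.
Proof.
move=> [F1 F2]; rewrite !disk_integralE; apply: eqC => /=.
  by apply: dint_ext => p _; rewrite ReJ.
by rewrite -dintN//; apply: dint_ext => p _; rewrite ImJ.
Qed.

Lemma disk_integral1 : disk_integral g (fun=> 1) = 1.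
Proof.
rewrite disk_integralE /= dint1.
have -> : dint (fun=> 0) = 0; last by [].
rewrite -[RHS](mul0r (dint (fun=> 0))) -(dintZ 0 _ (bmeas_cst 0)).
by apply: dint_ext => p _; rewrite mul0r.
Qed.

Lemma disk_integralB F H : cbmeas F -> cbmeas H ->
  disk_integral g (fun z => F z - H z) = disk_integral g F - disk_integral g H.
Proof.
move=> hF hH; rewrite -mulN1r -disk_integralZ// -disk_integralD//; last first.
  exact: cbmeasM (cbmeas_cst _) hH.
by apply: disk_integral_ext => z _; rewrite mulN1r.
Qed.

End DiskIntegral.

(** * Stokes' theorem with a weight vanishing on the circle *)

Section Stokes.
Context {R : realType}.
Variable g : R.
Hypothesis g1 : -1 < g.
Notation mu := (@lebesgue_measure R).
Notation RR := (measurableTypeR R * measurableTypeR R)%type.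
Notation D := (@planar_disk R : set RR).
Implicit Types (f h u ux : RR -> R) (F H : R[i] -> R[i]).

Lemma planar_disk_lt1 (p : RR) : D p <-> sqnorm p < 1.
Proof.
rewrite planar_diskE /= in_itv /=; split=> [/andP[]//|->].
by rewrite andbT addr_ge0 ?sqr_ge0.
Qed.

(* Subtracting the constant [d `^ (g + 1)] makes the primitive vanish at both
   ends of the section of the disk of squared radius [1 - d]. *)
Lemma section_integral_eq0 (U U' : R -> R) (k d : R) : 0 < d -> 0 <= k ->
  (forall x, x ^+ 2 + k < 1 -> is_derive x 1 U (U' x)) ->
  (forall x, x ^+ 2 + k < 1 -> {for x, continuous U'}) ->
  (\int[mu]_x (((fun x => (U' x * ((1 - (x ^+ 2 + k)) `^ (g + 1) - d `^ (g + 1)) -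
     2 * (g + 1) * x * U x * (1 - (x ^+ 2 + k)) `^ g)%:E) \_
     [set x | (x ^+ 2 + k <= 1 - d)%R]) x) = 0)%E.
Proof.
move=> d0 k0 dU cU.
rewrite -integral_mkcond.
have [kd|kd] := ltP (1 - d - k) 0.
  rewrite (_ : [set x | _] = set0) ?integral_set0//.
  apply/seteqP; split => x //= h; have := sqr_ge0 x; lra.
pose r := Num.sqrt (1 - d - k).
have r0 : 0 <= r by exact: sqrtr_ge0.
have rr : r ^+ 2 = 1 - d - k by rewrite sqr_sqrtr.
have rE (x : R) : (x ^+ 2 + k <= 1 - d) = (- r <= x <= r).
  rewrite -[RHS]ler_norml -[RHS]ler_sqr ?nnegrE// real_normK ?num_real// rr.
  by apply/idP/idP; lra.
have -> : [set x | x ^+ 2 + k <= 1 - d] = `[- r, r]%classic.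
  by apply/seteqP; split => x /=; rewrite in_itv /= rE.
pose w (x : R) : R := 1 - (x ^+ 2 + k).
have w0 (x : R) : - r <= x <= r -> 0 < w x by rewrite -rE /w; lra.
have dw (x : R) : is_derive x 1 w (- 2 * x).
  have d1 := is_derive_funM _ _ _ _ _ (is_derive_id x 1) (is_derive_id x 1).
  have d2 := is_derive_funB _ _ _ _ _ (is_derive_fun_cst x 1)
    (is_derive_funD _ _ _ _ _ d1 (is_derive_fun_cst x k)).
  have -> : w = fun x => 1 - (x * x + k) by apply/funext => y; rewrite /w expr2.
  by apply: (is_derive_fun_eq _ _ _ _ _ d2); ring.
have dpow (x s : R) : - r <= x <= r ->
    is_derive x 1 (fun x => w x `^ s) (s * w x `^ (s - 1) * (- 2 * x)).
  move=> xr; have p := is_derive1_powR s (w0 _ xr).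
  exact: (is_derive_fun_comp (fun x => x `^ s) _ _ _ _ p (dw x)).
have dF (x : R) : - r <= x <= r ->
    is_derive x 1 (fun x => U x * (w x `^ (g + 1) - d `^ (g + 1)))
     (U' x * (w x `^ (g + 1) - d `^ (g + 1)) - 2 * (g + 1) * x * U x * w x `^ g).
  move=> xr.
  have dUx : is_derive x 1 U (U' x) by apply: dU; move: xr; rewrite -rE; lra.
  have d1 := is_derive_funB _ _ _ _ _ (dpow x (g + 1) xr)
    (is_derive_fun_cst x (d `^ (g + 1))).
  apply: (is_derive_fun_eq _ _ _ _ _ (is_derive_funM _ _ _ _ _ dUx d1)).
  by rewrite addrK; ring.
have cts (x : R) : - r <= x <= r -> {for x, continuous (fun x =>
     U' x * (w x `^ (g + 1) - d `^ (g + 1)) - 2 * (g + 1) * x * U x * w x `^ g)}.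
  move=> xr.
  have xd : x ^+ 2 + k < 1 by move: xr; rewrite -rE; lra.
  have cw s : {for x, continuous (fun x => w x `^ s)}.
    apply: differentiable_continuous; apply/derivable1_diffP.
    exact: (@ex_derive _ _ _ _ _ _ _ (dpow x s xr)).
  have cU0 : {for x, continuous U}.
    apply: differentiable_continuous; apply/derivable1_diffP.
    exact: (@ex_derive _ _ _ _ _ _ _ (dU x xd)).
  apply: cvgB.
    apply: cvgM; first exact: cU.
    by apply: cvgB; [exact: cw|exact: cvg_cst].
  apply: cvgM; last exact: cw.
  apply: cvgM; last exact: cU0.
  by apply: cvgM; [exact: cvg_cst|exact: cvg_id].
have rNr : - r <= r by lra.
rewrite (FTC2_closed _ _ _ _ rNr dF cts).
have wr : w r = d by rewrite /w rr; lra.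
have wNr : w (- r) = d by rewrite /w sqrrN rr; lra.
by rewrite wr wNr !subrr !mulr0 subrr.
Qed.

(** Fubini's theorem over horizontal sections, whose integrals are of the kind treated in
    [section_integral_eq0]. *)
Lemma truncated_integral (d : R) (S : RR -> R) :
  (forall y, (\int[mu]_x ((fun x => (S (x, y))%:E) \_ [set x | (x ^+ 2 + y ^+ 2 <= 1 - d)%R]) x = 0)%E) ->
  (area R).-integrable [set p | sqnorm p <= 1 - d] (EFin \o S) ->
  (\int[area R]_(p in [set p | (sqnorm p <= 1 - d)%R]) (S p)%:E = 0)%E.
Proof.
move=> hS iS; rewrite integral_mkcond.
have iS' := (integrable_mkcond _ (measurable_sqnorm_le (1 - d))).1 iS.
rewrite -(integral21_prod_meas1 iS').
apply: integral0_eq => y _; rewrite /fubini_G -[RHS](hS y).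
by apply: eq_integral => x _; rewrite /patch !mem_setE.
Qed.

Lemma area_sqnorm_le_lty (t : R) : (area R [set p | (sqnorm p <= t)%R] < +oo)%E.
Proof.
by apply: le_lt_trans (ltry (pi * Num.max t 0)); rewrite -area_sqnorm_le.
Qed.

Lemma bmeas_x1 : bmeas (fun p : RR => p.1).
Proof. by have [] := @cbmeas_id R. Qed.

Lemma bmeas_x2 : bmeas (fun p : RR => p.2).
Proof. by have [] := @cbmeas_id R. Qed.

Lemma bmeas_sqnorm : bmeas (@sqnorm R).
Proof.
apply: bmeas_ext (bmeasD _ _ (bmeasM _ _ bmeas_x1 bmeas_x1) (bmeasM _ _ bmeas_x2 bmeas_x2)).
by move=> p _; rewrite /sqnorm !expr2.
Qed.

(** Up to the constant [c], the integrand times the density is the x-derivative of u (1 -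
    |p|^2)^(g+1). On the smaller disk [Dn n] the boundary leaves a multiple of the integral of [ux]
    by the power g + 1 of [dl n], which tends to 0 since g + 1 > 0. *)
Lemma stokes_x u ux : bmeas u -> bmeas ux ->
  (forall p, D p -> is_derive p.1 1 (fun x => u (x, p.2)) (ux p)) ->
  (forall p, D p -> {for p.1, continuous (fun x => ux (x, p.2))}) ->
  dint g (fun p => ux p * (1 - sqnorm p) - 2 * (g + 1) * p.1 * u p) = 0.
Proof.
move=> hu hux du cu.
pose q p := ux p * (1 - sqnorm p) - 2 * (g + 1) * p.1 * u p.
have hq : bmeas q.
  apply: bmeasB.
    by apply: bmeasM => //; apply: bmeasB; [exact: bmeas_cst|exact: bmeas_sqnorm].
  by apply: bmeasM => //; apply: bmeasM; [exact: bmeas_cst|exact: bmeas_x1].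
pose Q (p : RR) : R := q p * density g (p.1 +i* p.2).
have iQ : (area R).-integrable D (EFin \o Q) by exact: bmeas_integrable.
pose c : R := (g + 1) / pi.
pose dl (n : nat) : R := n.+2%:R^-1.
have dl0 n : 0 < dl n by rewrite invr_gt0.
pose Dn n : set RR := [set p | sqnorm p <= 1 - dl n].
have mDn n : measurable (Dn n) by exact: measurable_sqnorm_le.
have DnD n : Dn n `<=` D.
  by move=> p; rewrite /Dn /= planar_disk_lt1; have := dl0 n; lra.
have [mux [M hM]] := hux.
have iux n : (area R).-integrable (Dn n) (EFin \o ux).
  apply: measurable_bounded_integrable => //.
  - exact: area_sqnorm_le_lty.
  - exact: measurable_funS measurable_planar_disk (DnD n) mux.
  - exists M; split; first exact: num_real.
    by move=> x Mx p /DnD Dp /=; rewrite (le_trans (hM _ Dp))// ltW.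
have iQn n : (area R).-integrable (Dn n) (EFin \o Q).
  exact: integrableS measurable_planar_disk (mDn n) (DnD n) iQ.
have stepn n : (\int[area R]_(p in Dn n) Q p)%R =
    c * dl n `^ (g + 1) * (\int[area R]_(p in Dn n) ux p)%R.
  rewrite -RintegralZl//; apply/eqP; rewrite -subr_eq0 -RintegralB//; last first.
    rewrite (_ : _ \o _ = fun p => (c * dl n `^ (g + 1))%:E * (EFin \o ux) p)%E; last first.
      by apply/funext => p /=; rewrite EFinM.
    exact: integrableZl.
  rewrite /Rintegral.
  (* Writing w for 1 - |p|^2, [S] is the x-derivative of c u (w^(g+1) - (dl n)^(g+1)), which
     vanishes at both ends of each section. *)
  pose S p := Q p - c * dl n `^ (g + 1) * ux p.
  rewrite -[X in fine X == _]/(\int[area R]_(p in Dn n) (S p)%:E)%E truncated_integral//.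
    move=> y.
    have d1 (x : R) : x ^+ 2 + y ^+ 2 < 1 ->
        is_derive x 1 (fun x => c * u (x, y)) (c * ux (x, y)).
      move=> xy; have := du (x, y); rewrite planar_disk_lt1 /= => /(_ xy) dx.
      apply: (is_derive_fun_eq _ _ _ _ _ (is_derive_funM _ _ _ _ _ (is_derive_fun_cst x c) dx)).
      by rewrite mul0r add0r.
    have c1 (x : R) : x ^+ 2 + y ^+ 2 < 1 -> {for x, continuous (fun x => c * ux (x, y))}.
      move=> xy; have := cu (x, y); rewrite planar_disk_lt1 /= => /(_ xy) cx.
      by apply: cvgM; [exact: cvg_cst|exact: cx].
    rewrite -[RHS](section_integral_eq0 _ _ _ _ (dl0 n) (sqr_ge0 y) d1 c1).
    apply: eq_integral => x _; rewrite !patchE; case: ifPn => //.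
    rewrite inE /= => hx; congr EFin.
    rewrite /S /Q /q /density sqr_cmod_pair -/c /sqnorm /=.
    set w := 1 - (x ^+ 2 + y ^+ 2).
    have w0 : 0 < w by rewrite /w; have := dl0 n; lra.
    have -> : w `^ (g + 1) = w `^ g * w.
      by rewrite powRD ?powRr1 ?ltW// (gt_eqF w0) implybT.
    by ring.
  rewrite (_ : _ \o _ = fun p => (EFin \o Q) p - (c * dl n `^ (g + 1))%:E * (EFin \o ux) p)%E; last first.
    by apply/funext => p /=; rewrite EFinB EFinM.
  have iZ := integrableZl (mDn n) (c * dl n `^ (g + 1)) (iux n).
  have iB := integrableB (mDn n) (iQn n) iZ.
  exact iB.
have dlcvg : dl n @[n --> \oo] --> (0 : R).
  by have := @cvg_harmonic R; rewrite -cvg_shiftS.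
have powcvg : dl n `^ (g + 1) @[n --> \oo] --> (0 : R).
  have g0 : 0 < g + 1 by rewrite -ltrBlDr sub0r.
  by have /cvg_at_rightP := @powR_cvg0 R (g + 1) g0; apply.
(* Dominated convergence: |Q| is integrable and dominates the truncations of [Q] to the disks
   [Dn n]. *)
have lim1 : (\int[area R]_(p in Dn n) Q p)%R @[n --> \oo] --> dint g q.
  apply: fine_cvg.
  rewrite fineK; last first.
    by apply: integrable_fin_num => //; exact: measurable_planar_disk.
  pose Qn n (p : RR) := ((EFin \o Q) \_ (Dn n)) p.
  have mQ : measurable_fun D (EFin \o Q) by exact: measurable_int iQ.
  have mQn n : measurable_fun D (Qn n).
    apply: measurable_funTS; apply/(measurable_restrictT _ (mDn n)).
    exact: measurable_int (iQn n).
  have cvgQ : {ae area R, forall p, D p -> Qn n p @[n --> \oo] --> (EFin \o Q) p}.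
    apply: aeW => p; rewrite planar_disk_lt1 => Dp.
    apply: cvg_near_cst.
    have : \forall n \near \oo, dl n < 1 - sqnorm p.
      by move/cvgrPdist_lt : dlcvg => /(_ (1 - sqnorm p)); rewrite subr_gt0 => /(_ Dp);
         apply: filterS => n; rewrite sub0r normrN gtr0_norm.
    apply: filterS => n hn; rewrite /Qn patchE mem_set// /Dn /=.
    lra.
  have domQ : {ae area R, forall p n, D p -> (`|Qn n p| <= `|(EFin \o Q) p|)%E}.
    apply: aeW => p n Dp; rewrite /Qn patchE; case: ifPn => // _.
    by rewrite abse0.
  have [_ _] := dominated_convergence measurable_planar_disk mQn mQ cvgQ
    (integrable_abse iQ) domQ.
  rewrite (_ : [sequence _]_n = fun n => (\int[area R]_(p in Dn n) (Q p)%:E)%E)//.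
  apply/funext => n; rewrite -(setIidr (DnD n)) integral_mkcondr.
  exact: eq_integral.
have lim0 : (\int[area R]_(p in Dn n) Q p)%R @[n --> \oo] --> (0 : R).
  (* [K] is |c| times a bound for the integral of |ux| over any [Dn n], whose area is at most pi. *)
  pose K := `|c| * (`|M| * pi).
  have hK : dl n `^ (g + 1) * K @[n --> \oo] --> (0 : R).
    rewrite -[X in _ --> X](mul0r K).
    by apply: cvgM => //; exact: cvg_cst.
  apply: (@squeeze_cvgr _ _ _ _ (fun n => - (dl n `^ (g + 1) * K)) (fun n => dl n `^ (g + 1) * K)) => //.
  - apply: nearW => n; rewrite -ler_norml stepn normrM normrM [`|_ `^ _|]ger0_norm ?powR_ge0//.
    rewrite [`|c| * _]mulrC -mulrA ler_wpM2l ?powR_ge0// ler_wpM2l//.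
    apply: le_trans (le_normr_Rintegral (mDn n) (iux n)) _.
    apply: le_trans (_ : (\int[area R]_(p in Dn n) `|M|)%R <= _).
      apply: le_Rintegral => //.
      + exact: integrable_abse (iux n).
      + apply: measurable_bounded_integrable => //; first exact: area_sqnorm_le_lty.
        exact: bounded_cst.
      + by move=> p /DnD Dp; apply: le_trans (hM _ Dp) (ler_norm _).
    rewrite Rintegral_cst// ler_wpM2l//.
    have -> : area R (Dn n) = (pi * Num.max (1 - dl n) 0)%:E := area_sqnorm_le (1 - dl n).
    rewrite /= ler_piMr ?pi_ge0// ge_max ler01 andbT lerBlDr lerDl ltW//.
  - by rewrite -[X in _ --> X]oppr0; exact: cvgN.
by have := cvg_unique _ lim1 lim0; apply.
Qed.

End Stokes.

(** * Stokes' theorem in terms of the derivative with respect to z *)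

Section ComplexStokes.
Context {R : realType}.
Variable g : R.
Hypothesis g1 : -1 < g.
Notation mu := (@lebesgue_measure R).
Notation RR := (measurableTypeR R * measurableTypeR R)%type.
Notation D := (@planar_disk R : set RR).
Implicit Types (f h u uy : RR -> R) (F H : R[i] -> R[i]).

Let swp (p : RR) : RR := (p.2, p.1).

Lemma planar_disk_swap (p : RR) : D (swp p) <-> D p.
Proof. by rewrite !planar_disk_lt1 /sqnorm /= addrC. Qed.

Lemma bmeas_swap f : bmeas f -> bmeas (f \o swp).
Proof.
move=> [mf [M hM]]; split; last by exists M => p /planar_disk_swap /hM.
have mswp : measurable_fun D swp by apply: measurable_funTS; exact: measurable_swap.
apply: (measurable_comp measurable_planar_disk _ mf mswp).
by move=> _ [p /planar_disk_swap Dp <-].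
Qed.

(** The two orders of integration in Fubini's theorem, together with the symmetry of the disk and of
    the density, replace a change of variables. *)
Lemma dint_swap f : bmeas f -> dint g (f \o swp) = dint g f.
Proof.
move=> hf.
have i1 := bmeas_integrable g g1 _ hf.
have i2 := bmeas_integrable g g1 _ (bmeas_swap _ hf).
have j1 := (integrable_mkcond _ measurable_planar_disk).1 i1.
have j2 := (integrable_mkcond _ measurable_planar_disk).1 i2.
rewrite /dint /Rintegral; congr fine.
rewrite integral_mkcond [RHS]integral_mkcond.
rewrite -[LHS](integral12_prod_meas1 j2) -[RHS](integral21_prod_meas1 j1).
apply: eq_integral => x _; rewrite /fubini_F /fubini_G.
apply: eq_integral => y _; rewrite !patchE.
have -> : ((x, y) \in D) = ((y, x) \in D).
  by apply/idP/idP; rewrite !inE => /planar_disk_swap.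
by case: ifPn => // _; rewrite /= /density !sqr_cmod /= [y ^+ 2 + _]addrC.
Qed.

Lemma stokes_y u uy : bmeas u -> bmeas uy ->
  (forall p, D p -> is_derive p.2 1 (fun y => u (p.1, y)) (uy p)) ->
  (forall p, D p -> {for p.2, continuous (fun y => uy (p.1, y))}) ->
  dint g (fun p => uy p * (1 - sqnorm p) - 2 * (g + 1) * p.2 * u p) = 0.
Proof.
move=> hu huy du cu.
have bq : bmeas (fun p => uy p * (1 - sqnorm p) - 2 * (g + 1) * p.2 * u p).
  apply: bmeasB.
    by apply: bmeasM => //; apply: bmeasB; [exact: bmeas_cst|exact: bmeas_sqnorm].
  by apply: bmeasM => //; apply: bmeasM; [exact: bmeas_cst|exact: bmeas_x2].
rewrite -dint_swap//.
rewrite -[RHS](@stokes_x _ g g1 (u \o swp) (uy \o swp)); last 4 first.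
- exact: bmeas_swap.
- exact: bmeas_swap.
- by move=> p /planar_disk_swap /du.
- by move=> p /planar_disk_swap /cu.
by apply: dint_ext => p _; rewrite /= /sqnorm /= [p.2 ^+ 2 + _]addrC.
Qed.

Lemma cbmeas_sqr_cmod : cbmeas (fun z : R[i] => (1 - cmod z ^+ 2)%:C).
Proof.
apply: (cbmeas_ext (fun z => 1 - z * z^*)); first by move=> z _; rewrite mulcJ rcD rcN.
by apply: cbmeasB (cbmeas_cst _) (cbmeasM _ _ cbmeas_id (cbmeasJ _ cbmeas_id)).
Qed.

(* [dF] and [dbF] are the Wirtinger derivatives of [F] with respect to [z] and
   to its conjugate. *)
Lemma stokes_wirtinger F (dF dbF : R[i] -> R[i]) : cbmeas F -> cbmeas dF -> cbmeas dbF ->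
  (forall z w t, disk (z + t%:C * w) -> cder (fun t => F (z + t%:C * w)) t
     (dF (z + t%:C * w) * w + dbF (z + t%:C * w) * w^*)) ->
  (forall z w t, disk (z + t%:C * w) -> exists d, cder (fun t => dF (z + t%:C * w)) t d) ->
  (forall z w t, disk (z + t%:C * w) -> exists d, cder (fun t => dbF (z + t%:C * w)) t d) ->
  disk_integral g (fun z => dF z * (1 - cmod z ^+ 2)%:C) =
  (g + 1)%:C * disk_integral g (fun z => z^* * F z).
Proof.
move=> hF hd hb derF derd derb.
have xE (y x : R) : (0 +i* y) + x%:C * 1 = x +i* y by apply: eqC => /=; ring.
have yE (x y : R) : (x +i* 0) + y%:C * 'i%C = x +i* y by apply: eqC => /=; ring.
pose Fx z := dF z + dbF z.
pose Fy z := 'i%C * (dF z - dbF z).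
have hFx : cbmeas Fx by exact: cbmeasD.
have hFy : cbmeas Fy by apply: cbmeasM (cbmeas_cst _) _; exact: cbmeasB.
have dx (p : RR) : D p -> cder (fun x => F (x +i* p.2)) p.1 (Fx (p.1 +i* p.2)).
  move=> Dp; have := derF (0 +i* p.2) 1 p.1; rewrite xE => /(_ Dp).
  by under eq_fun do rewrite xE; move=> h; apply: cder_eq h _; rewrite /Fx rmorph1 !mulr1.
have dy (p : RR) : D p -> cder (fun y => F (p.1 +i* y)) p.2 (Fy (p.1 +i* p.2)).
  move=> Dp; have := derF (p.1 +i* 0) 'i%C p.2; rewrite yE => /(_ Dp).
  under eq_fun do rewrite yE; move=> h; apply: cder_eq h _; rewrite /Fy.
  by apply: eqC; rewrite ?ReD ?ImD ?ReM ?ImM ?ReD ?ImD ?ReN ?ImN /=; ring.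
have cx (p : RR) : D p -> exists d, cder (fun x => Fx (x +i* p.2)) p.1 d.
  move=> Dp; have [d h] : exists d, cder (fun x => dF (x +i* p.2)) p.1 d.
    have := derd (0 +i* p.2) 1 p.1; rewrite xE => /(_ Dp)[d' hd'].
    by exists d'; move: hd'; under eq_fun do rewrite xE.
  have [e h'] : exists d, cder (fun x => dbF (x +i* p.2)) p.1 d.
    have := derb (0 +i* p.2) 1 p.1; rewrite xE => /(_ Dp)[d' hd'].
    by exists d'; move: hd'; under eq_fun do rewrite xE.
  by exists (d + e); exact: cderD.
have cy (p : RR) : D p -> exists d, cder (fun y => Fy (p.1 +i* y)) p.2 d.
  move=> Dp; have [d h] : exists d, cder (fun y => dF (p.1 +i* y)) p.2 d.
    have := derd (p.1 +i* 0) 'i%C p.2; rewrite yE => /(_ Dp)[d' hd'].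
    by exists d'; move: hd'; under eq_fun do rewrite yE.
  have [e h'] : exists d, cder (fun y => dbF (p.1 +i* y)) p.2 d.
    have := derb (p.1 +i* 0) 'i%C p.2; rewrite yE => /(_ Dp)[d' hd'].
    by exists d'; move: hd'; under eq_fun do rewrite yE.
  eexists; apply: cderM; first exact: cder_cst.
  by apply: cderD h (cderN _ _ _ h').
pose G1 z := Fx z * (1 - cmod z ^+ 2)%:C - (2 * (g + 1))%:C * (complex.Re z)%:C * F z.
pose G2 z := Fy z * (1 - cmod z ^+ 2)%:C - (2 * (g + 1))%:C * (complex.Im z)%:C * F z.
have hRe : cbmeas (fun z : R[i] => (complex.Re z)%:C) by exact: cbmeas_Re cbmeas_id.
have hIm : cbmeas (fun z : R[i] => (complex.Im z)%:C).
  apply: (cbmeas_ext (fun z => (complex.Re (- 'i%C * z))%:C)).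
    by move=> z _; congr (_ %:C); rewrite ReM /=; ring.
  by apply: cbmeas_Re; apply: cbmeasM (cbmeas_cst _) cbmeas_id.
have hG1 : cbmeas G1.
  apply: cbmeasB; first exact: cbmeasM hFx cbmeas_sqr_cmod.
  by apply: cbmeasM => //; apply: cbmeasM (cbmeas_cst _) _.
have hG2 : cbmeas G2.
  apply: cbmeasB; first exact: cbmeasM hFy cbmeas_sqr_cmod.
  by apply: cbmeasM => //; apply: cbmeasM (cbmeas_cst _) _.
have [F1 F2] := hF; have [Fx1 Fx2] := hFx; have [Fy1 Fy2] := hFy.
have I1 : disk_integral g G1 = 0.
  rewrite disk_integralE; apply: eqC => /=.
    rewrite -[RHS](stokes_x g g1 _ _ F1 Fx1); last 2 first.
    - by move=> p /dx[].
    - by move=> p /cx[d /cder_cont[]].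
    apply: dint_ext => p _; rewrite /G1 sqr_cmod_pair !(ReD, ReN, ReM, ImD, ImN, ImM) /=; ring.
  rewrite -[RHS](stokes_x g g1 _ _ F2 Fx2); last 2 first.
  - by move=> p /dx[].
  - by move=> p /cx[d /cder_cont[]].
  apply: dint_ext => p _; rewrite /G1 sqr_cmod_pair !(ReD, ReN, ReM, ImD, ImN, ImM) /=; ring.
have I2 : disk_integral g G2 = 0.
  rewrite disk_integralE; apply: eqC => /=.
    rewrite -[RHS](stokes_y _ _ F1 Fy1); last 2 first.
    - by move=> p /dy[].
    - by move=> p /cy[d /cder_cont[]].
    apply: dint_ext => p _; rewrite /G2 sqr_cmod_pair !(ReD, ReN, ReM, ImD, ImN, ImM) /=; ring.
  rewrite -[RHS](stokes_y _ _ F2 Fy2); last 2 first.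
  - by move=> p /dy[].
  - by move=> p /cy[d /cder_cont[]].
  apply: dint_ext => p _; rewrite /G2 sqr_cmod_pair !(ReD, ReN, ReM, ImD, ImN, ImM) /=; ring.
have hw : cbmeas (fun z => dF z * (1 - cmod z ^+ 2)%:C) by exact: cbmeasM cbmeas_sqr_cmod.
have hz : cbmeas (fun z => z^* * F z) by apply: cbmeasM => //; exact: cbmeasJ cbmeas_id.
have e : disk_integral g (fun z => 2 * (dF z * (1 - cmod z ^+ 2)%:C -
    (g + 1)%:C * (z^* * F z))) = 0.
  (* The combination G1 - i G2 isolates the z-derivative: Fx - i Fy = 2 dF, and Re z - i Im z =
     conj(z). *)
  have -> : 0 = disk_integral g G1 + - 'i%C * disk_integral g G2.
    by rewrite I1 I2 mulr0 addr0.
  rewrite -disk_integralZ// -disk_integralD//; last exact: cbmeasM (cbmeas_cst _) hG2.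
  apply: disk_integral_ext => z _; rewrite /G1 /G2 /Fx /Fy.
  move: (dF z) (dbF z) (F z) (cmod z) => [a b] [c d] [e f] k.
  case: z => x y.
  by apply: eqC; rewrite !(ReD, ReN, ReM, ImD, ImN, ImM) /=; ring.
have hzz : cbmeas (fun z => (g + 1)%:C * (z^* * F z)) by exact: cbmeasM (cbmeas_cst _) hz.
move: e; rewrite disk_integralZ//; last exact: cbmeasB.
rewrite disk_integralB// disk_integralZ// => /eqP.
by rewrite mulf_eq0 (pnatr_eq0 _ 2) /= subr_eq0 => /eqP.
Qed.

End ComplexStokes.

(** * Scalar products of kernels *)

Section Reproducing.
Context {R : realType}.
Variable g : R.
Hypothesis g1 : -1 < g.
Notation RR := (measurableTypeR R * measurableTypeR R)%type.
Notation D := (@planar_disk R : set RR).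
Implicit Types (a b z w xi : R[i]) (s t : R).

Definition kpow a s z : R[i] := cpow (1 - a^* * z) s.

Lemma cder_kpow a s z w t : disk a -> disk (z + t%:C * w) ->
  cder (fun t => kpow a s (z + t%:C * w)) t
    (s%:C * (- (a^* * w)) * kpow a (s - 1) (z + t%:C * w)).
Proof.
move=> ha hz; apply: (@cder_pow _ (fun t => 1 - a^* * (z + t%:C * w))).
  exact: Re_kernel_gt0.
have h : cder (fun t => 1 - a^* * (z + t%:C * w)) t (0 - (0 * (z + t%:C * w) + a^* * w)).
  apply: cderD (cder_cst _ _) (cderN _ _ _ _).
  by apply: cderM (cder_cst _ _) (cder_line _ _ _).
by apply: cder_eq h _; rewrite mul0r !add0r.
Qed.

Lemma kpowS a s z : disk a -> disk z -> kpow a (s + 1) z = kpow a s z * (1 - a^* * z).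
Proof. by move=> ha hz; rewrite /kpow cpowD ?cpow_r1// Re_kernel_gt0. Qed.

Lemma disk0 : disk (0 : R[i]).
Proof. by rewrite /disk /= cmod0 ltr01. Qed.

Lemma kpow0 s z : kpow 0 s z = 1.
Proof. by rewrite /kpow conjC0 mul0r subr0 cpow_1r. Qed.

Let P a b z := kpow a (- (g + 2)) z * (kpow b (- (g + 2) - 1) z)^*.

Lemma cbmeas_P a b : disk a -> disk b -> cbmeas (P a b).
Proof.
by move=> ha hb; apply: cbmeasM; [|apply: cbmeasJ]; exact: cbmeas_kernel.
Qed.

(* The function F below has z-derivative proportional to [a^* * P a b], and
   a^* (1 - z z^* ) - z^* (1 - a^* z) = a^* - z^*. *)
Lemma kernel_moment a b : disk a -> disk b ->
  disk_integral g (fun z => z^* * P a b z) = a^* * disk_integral g (P a b).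
Proof.
move=> ha hb.
pose F z := kpow a (- (g + 2) + 1) z * (kpow b (- (g + 2) - 1) z)^*.
pose dF z := (g + 1)%:C * (a^* * P a b z).
pose dbF z := kpow a (- (g + 2) + 1) z *
  (- (g + 2 + 1)%:C * - b^* * kpow b (- (g + 2) - 1 - 1) z)^*.
have hP := cbmeas_P a b ha hb.
have haP : cbmeas (fun z => a^* * P a b z) by exact: cbmeasM (cbmeas_cst _) hP.
have hdF : cbmeas dF by exact: cbmeasM (cbmeas_cst _) haP.
have hF : cbmeas F by apply: cbmeasM; [|apply: cbmeasJ]; exact: cbmeas_kernel.
have hdbF : cbmeas dbF.
  apply: cbmeasM; [|apply: cbmeasJ]; first exact: cbmeas_kernel.
  by apply: cbmeasM (cbmeas_cst _) _; exact: cbmeas_kernel.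
have := stokes_wirtinger g g1 F dF dbF hF hdF hdbF.
have -> : disk_integral g (fun z => dF z * (1 - cmod z ^+ 2)%:C) =
   (g + 1)%:C * disk_integral g (fun z => a^* * P a b z * (1 - cmod z ^+ 2)%:C).
  rewrite -disk_integralZ//; last exact: cbmeasM haP cbmeas_sqr_cmod.
  by apply: disk_integral_ext => z _; rewrite /dF [RHS]mulrA.
have g0 : (g + 1)%:C != 0 :> R[i].
  by rewrite -[0]/(0%:C) (inj_eq (@complexI _)) gt_eqF// -ltrBlDr sub0r.
move=> /(_ _ _ _)/(mulfI g0) h.
have {}h : disk_integral g (fun z => a^* * P a b z * (1 - cmod z ^+ 2)%:C) =
    disk_integral g (fun z => z^* * F z).
  apply: h.
  - move=> z w t hz; have ka := cder_kpow a (- (g + 2) + 1) z w t ha hz.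
    have kb := cder_kpow b (- (g + 2) - 1) z w t hb hz.
    apply: cder_eq (cderM _ _ _ _ _ ka (cderJ _ _ _ kb)) _.
    rewrite /dF /dbF /P addrK.
    have -> : (- (g + 2) + 1)%:C = - (g + 1)%:C :> R[i] by rewrite -rcN; congr (_ %:C); ring.
    have -> : (- (g + 2) - 1)%:C = - (g + 2 + 1)%:C :> R[i] by rewrite -rcN; congr (_ %:C); ring.
    move: (kpow a (- (g + 2)) _) (kpow a (- (g + 2) + 1) _) => k1 k2.
    move: (kpow b (- (g + 2) - 1) _) (kpow b (- (g + 2) - 1 - 1) _) => k3 k4.
    rewrite !rmorphM !rmorphN !rmorphM /=; ring.
  - move=> z w t hz; eexists; apply: cderM; first exact: cder_cst.
    apply: cderM; first exact: cder_cst.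
    apply: cderM; first exact: cder_kpow.
    by apply: cderJ; exact: cder_kpow.
  - move=> z w t hz; eexists; apply: cderM; first exact: cder_kpow.
    apply: cderJ; apply: cderM; first exact: cder_cst.
    exact: cder_kpow.
have hz : cbmeas (fun z => z^* * P a b z) by exact: cbmeasM (cbmeasJ _ cbmeas_id) hP.
have : disk_integral g (fun z => a^* * P a b z * (1 - cmod z ^+ 2)%:C) -
    disk_integral g (fun z => z^* * F z) = 0 by rewrite h subrr.
rewrite -disk_integralB//; last 2 first.
- exact: cbmeasM haP cbmeas_sqr_cmod.
- by apply: cbmeasM hF; exact: cbmeasJ cbmeas_id.
have -> : disk_integral g (fun z => a^* * P a b z * (1 - cmod z ^+ 2)%:C - z^* * F z) =
    disk_integral g (fun z => a^* * P a b z - z^* * P a b z).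
  apply: disk_integral_ext => z dz.
  rewrite /F kpowS// rcD rcN -mulcJ /P.
  by move: (kpow a _ _) (kpow b _ _) => k1 k2; ring.
rewrite disk_integralB// disk_integralZ// => /eqP.
by rewrite subr_eq0 => /eqP <-.
Qed.

Definition kernel_form a b : R[i] :=
  disk_integral g (fun z => kpow a (- (g + 2)) z * (kpow b (- (g + 2)) z)^*).

(** The factor 1 - b conj(z) turns the second factor of [P a b] back into a conjugate kernel. The
    form is thus the integral of P minus b times that of conj(z) P, which [kernel_moment]
    evaluates. *)
Lemma kernel_formE a b : disk a -> disk b ->
  kernel_form a b = (1 - a^* * b) * disk_integral g (P a b).
Proof.
move=> ha hb.
have hP := cbmeas_P a b ha hb.
have hz : cbmeas (fun z => z^* * P a b z) by exact: cbmeasM (cbmeasJ _ cbmeas_id) hP.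
rewrite mulrBl mul1r [a^* * b]mulrC -mulrA -kernel_moment// -disk_integralZ// -disk_integralB//.
  apply: disk_integral_ext => z dz; rewrite /P.
  rewrite -{2}[- (g + 2)](subrK 1) kpowS//.
  move: (kpow a _ _) (kpow b _ _) => k1 k2.
  rewrite rmorphM rmorphB rmorphM /= conjCK conjC1; ring.
exact: cbmeasM (cbmeas_cst _) hz.
Qed.

(** The constant bound on the derivative makes |M| times the density the integrable majorant for
    differentiation under the integral. *)
Lemma dint_derive (f df : R -> RR -> R) (u v t M : R) : u < t < v ->
  (forall x, u < x < v -> bmeas (f x)) ->
  (forall x p, u < x < v -> D p -> is_derive x 1 (f^~ p) (df x p)) ->
  (forall x p, u < x < v -> D p -> `|df x p| <= M) ->
  is_derive t 1 (fun x => dint g (f x)) (dint g (df t)).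
Proof.
move=> tuv hf hd hM.
pose h x (p : RR) := f x p * density g (p.1 +i* p.2).
have dh x p : u < x < v -> D p -> is_derive x 1 (h^~ p) (df x p * density g (p.1 +i* p.2)).
  move=> xuv Dp.
  apply: (is_derive_fun_eq _ _ _ _ _ (is_derive_funM _ _ _ _ _ (hd _ _ xuv Dp) (is_derive_fun_cst x _))).
  by rewrite mulr0 addr0.
have tI : `]u, v[%classic t by rewrite /= in_itv.
have ih x : `]u, v[%classic x -> (area R).-integrable D (EFin \o h x).
  by rewrite /= in_itv /= => xuv; exact: bmeas_integrable (hf _ xuv).
have derh x p : `]u, v[%classic x -> D p -> derivable (h^~ p) x 1.
  rewrite /= in_itv /= => xuv Dp; exact: (@ex_derive _ _ _ _ _ _ _ (dh _ _ xuv Dp)).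
have parh x p : u < x < v -> D p -> partial1of2 h x p = df x p * density g (p.1 +i* p.2).
  by move=> xuv Dp; rewrite partial1of2E (@derive_val _ _ _ _ _ _ _ (dh _ _ xuv Dp)).
pose G (p : RR) := `|M| * density g (p.1 +i* p.2).
have G0 p : 0 <= G p by rewrite mulr_ge0// density_ge0.
have iG : (area R).-integrable D (EFin \o G) by exact: bmeas_integrable (bmeas_cst _).
have hG x p : `]u, v[%classic x -> D p -> `|partial1of2 h x p| <= G p.
  rewrite /= in_itv /= => xuv Dp; rewrite parh// normrM (ger0_norm (density_ge0 _ _ _))//.
  rewrite ler_wpM2r ?density_ge0//; exact: le_trans (hM _ _ xuv Dp) (ler_norm _).
have e := differentiation_under_integral measurable_planar_disk tI ih derh G0 iG hG.
have d := derivable_under_integral measurable_planar_disk tI ih derh G0 iG hG.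
apply: DeriveDef; first exact: d.
rewrite -derive1E e; apply: eq_Rintegral => p; rewrite inE => Dp.
exact: parh.
Qed.

Lemma disk_integral_cder (F dF : R -> R[i] -> R[i]) (u v t M : R) : u < t < v ->
  (forall x, u < x < v -> cbmeas (F x)) ->
  (forall x z, u < x < v -> disk z -> cder (F^~ z) x (dF x z)) ->
  (forall x z, u < x < v -> disk z -> cmod (dF x z) <= M) ->
  cder (fun x => disk_integral g (F x)) t (disk_integral g (dF t)).
Proof.
move=> tuv hF hd hM; split => /=.
  apply: (dint_derive (fun x (p : RR) => complex.Re (F x (p.1 +i* p.2)))
    (fun x p => complex.Re (dF x (p.1 +i* p.2))) u v t M) => //.
  - by move=> x /hF[].
  - by move=> x p xuv Dp; have [] := hd _ _ xuv Dp.
  - by move=> x p xuv Dp; apply: le_trans (le_Re_cmod _) (hM _ _ xuv Dp).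
apply: (dint_derive (fun x (p : RR) => complex.Im (F x (p.1 +i* p.2)))
  (fun x p => complex.Im (dF x (p.1 +i* p.2))) u v t M) => //.
- by move=> x /hF[].
- by move=> x p xuv Dp; have [] := hd _ _ xuv Dp.
- by move=> x p xuv Dp; apply: le_trans (le_Im_cmod _) (hM _ _ xuv Dp).
Qed.

Lemma cder_kernel_form a b t : disk a -> disk b -> 0 <= t <= 1 ->
  cder (fun t => kernel_form a (t%:C * b)) t
    ((g + 2)%:C * b * disk_integral g (fun z => z^* * P a (t%:C * b) z)).
Proof.
move=> ha hb /andP[t0 t1].
pose c := cmod b.
have c0 : 0 <= c by exact: cmod_ge0.
have c1 : c < 1 by exact: hb.
(* Differentiation under the integral takes place on an open interval, which must contain [0, 1] and
   keep x b in a disk of radius [r] < 1. Here v c <= r amounts to (1 - c)^2 >= 0. *)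
pose v : R := 1 + (1 - c) / 2.
pose r : R := (1 + c) / 2.
have r1 : r < 1 by rewrite /r; lra.
have tb x : - v < x < v -> cmod (x%:C * b) <= r.
  move=> xv; rewrite cmodM cmod_real -/c.
  have {}xv : `|x| <= v by rewrite ler_norml; move: xv; lra.
  apply: le_trans (_ : v * c <= _); first by rewrite ler_wpM2r.
  rewrite /v /r; nra.
have dtb x : - v < x < v -> disk (x%:C * b).
  by move=> /tb h; rewrite /disk /=; apply: le_lt_trans r1.
have tv : - v < t < v by rewrite /v; lra.
have [M1 hM1] := cpow_kernel_bounded (cmod a) (- (g + 2)) ha.
have [M2 hM2] := cpow_kernel_bounded r (- (g + 2) - 1) r1.
pose dF x z := (g + 2)%:C * b * (z^* * P a (x%:C * b) z).
have hP := cbmeas_P a _ ha (dtb _ tv).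
have hz : cbmeas (fun z => z^* * P a (t%:C * b) z) by exact: cbmeasM (cbmeasJ _ cbmeas_id) hP.
rewrite -disk_integralZ//.
pose F x z := kpow a (- (g + 2)) z * (kpow (x%:C * b) (- (g + 2)) z)^*.
have hF x : - v < x < v -> cbmeas (F x).
  by move=> /dtb hx; apply: cbmeasM; [|apply: cbmeasJ]; exact: cbmeas_kernel.
have hd x z : - v < x < v -> disk z -> cder (F^~ z) x (dF x z).
  move=> /dtb hx dz.
  have k : cder (fun x => kpow (x%:C * b) (- (g + 2)) z) x
      ((- (g + 2))%:C * (- (b^* * z)) * kpow (x%:C * b) (- (g + 2) - 1) z).
    apply: (@cder_pow _ (fun x : R => 1 - (x%:C * b)^* * z)).
      exact: Re_kernel_gt0.
    have h : cder (fun x : R => 1 + x%:C * (- (b^* * z))) x (- (b^* * z)) by exact: cder_line.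
    rewrite (_ : (fun _ => _) = fun x : R => 1 + x%:C * (- (b^* * z)))//.
    apply/funext => y; rewrite rmorphM /= conj_real; ring.
  apply: cder_eq (cderM _ _ _ _ _ (cder_cst _ _) (cderJ _ _ _ k)) _.
  rewrite /dF /P mul0r add0r.
  move: (kpow a _ _) (kpow (x%:C * b) _ _) => k1 k2.
  rewrite rcN !conjM !conjN conjM conj_real conjCK; ring.
have hM x z : - v < x < v -> disk z -> cmod (dF x z) <= `|g + 2| * c * (1 * (M1 * M2)).
  move=> xv dz; rewrite /dF /P cmodM (cmodM _ b) cmod_real (cmodM z^*) (cmodM (kpow a _ _)) -/c.
  apply: ler_pM; [by rewrite mulr_ge0|by rewrite !mulr_ge0 ?cmod_ge0|by []|].
  apply: ler_pM; [exact: cmod_ge0|by rewrite !mulr_ge0 ?cmod_ge0|by rewrite cmodJ ltW|].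
  apply: ler_pM; [exact: cmod_ge0|exact: cmod_ge0|exact: hM1|].
  by rewrite cmodJ; apply: hM2 => //; exact: tb.
exact: (disk_integral_cder F dF _ _ _ _ tv hF hd hM).
Qed.

Lemma kernel_form_cpow a b : disk a -> disk b ->
  kernel_form a b * cpow (1 - a^* * b) (g + 2) = kernel_form a 0.
Proof.
move=> ha hb.
have dtb x : 0 <= x <= 1 -> disk (x%:C * b).
  move=> /andP[x0 x1]; rewrite /disk /= cmodM cmod_real ger0_norm//.
  by apply: le_lt_trans hb; rewrite ler_piMl ?cmod_ge0.
(* The summand 0 gives the argument the shape z + t w of [cder_kpow]. *)
pose Phi (t : R) := kernel_form a (t%:C * b) * kpow a (g + 2) (0 + t%:C * b).
have h : Phi 0 = Phi 1.
  apply: cder0_eq => // t t01.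
  have k1 := cder_kernel_form a b t ha hb t01.
  have htb : disk (0 + t%:C * b) by rewrite add0r; exact: dtb.
  have k2 := cder_kpow a (g + 2) 0 b t ha htb.
  apply: cder_eq (cderM _ _ _ _ _ k1 k2) _.
  have htb' := dtb _ t01.
  (* Both terms of the product rule become multiples of the same integral of P, with opposite
     coefficients once one factor 1 - conj(a) t b is split off the power. *)
  rewrite add0r kernel_moment// kernel_formE//.
  have -> : kpow a (g + 2) (t%:C * b) = kpow a (g + 2 - 1) (t%:C * b) * (1 - a^* * (t%:C * b)).
    by rewrite -kpowS// subrK.
  move: (kpow a _ _) (disk_integral _ _) => k d; ring.
have := h; rewrite /Phi !mul0r !mul1r !add0r => <-.
by rewrite /kpow mulr0 subr0 cpow_1r mulr1.
Qed.

Lemma kernel_form_eq a b : disk a -> disk b ->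
  kernel_form a b = cpow (1 - a^* * b) (- (g + 2)).
Proof.
move=> ha hb.
have h00 : kernel_form 0 0 = 1.
  rewrite -[RHS](disk_integral1 g g1); apply: disk_integral_ext => z _.
  by rewrite !kpow0 conjC1 mulr1.
(* Only the form at (0, 0) is the mass of the disk. The preceding lemma, with 0 as first parameter,
   carries the value 1 to (0, a), and conjugation exchanges the arguments. *)
have ha0 : kernel_form a 0 = 1.
  have := kernel_form_cpow 0 a disk0 ha.
  rewrite h00 conjC0 mul0r subr0 cpow_1r mulr1 => e.
  rewrite -conjC1 -e -disk_integralJ//.
    by apply: disk_integral_ext => z _; rewrite !kpow0 conjC1 mulr1 mul1r conjCK.
  by apply: cbmeasM; [|apply: cbmeasJ]; apply: cbmeas_kernel => //; exact: disk0.
have := kernel_form_cpow a b ha hb; rewrite ha0 => e.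
have p := Re_kernel_gt0 a b ha hb.
have n0 : cpow (1 - a^* * b) (g + 2) != 0.
  by apply: contra_eq_neq e => ->; rewrite mulr0 eq_sym oner_neq0.
by apply: (mulIf n0); rewrite e cpowN// mulVf.
Qed.

End Reproducing.

(** * The Berezin transform of the Weyl operator *)

Section Berezin.
Context {R : realType}.
Implicit Types (a b z w h xi c : R[i]) (s t : R).

(** * Holomorphy of the kernels and membership in the Bergman space *)

Lemma disk_segment z h t : disk z -> disk (z + h) -> 0 <= t <= 1 -> disk (z + t%:C * h).
Proof.
rewrite /disk /= => hz hh /andP[t0 t1].
have -> : z + t%:C * h = (1 - t)%:C * z + t%:C * (z + h) by rewrite rcD rcN; ring.
apply: le_lt_trans (le_cmodD _ _) _; rewrite !cmodM !cmod_real !ger0_norm ?subr_ge0//.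
rewrite -subr_gt0.
have -> : 1 - ((1 - t) * cmod z + t * cmod (z + h)) =
    (1 - t) * (1 - cmod z) + t * (1 - cmod (z + h)) by ring.
move: hz hh; rewrite -subr_gt0 -[cmod (z + h) < 1]subr_gt0 => hz hh.
have [->|tn0] := eqVneq t 0; first by rewrite mul0r addr0 subr0 mul1r.
apply: ltr_wpDl; first by rewrite mulr_ge0 ?(ltW hz)// subr_ge0.
by rewrite mulr_gt0// lt_neqAle eq_sym tn0.
Qed.

Lemma kpow_lipschitz a s : disk a -> exists2 M : R, 0 <= M &
  forall z h, disk z -> disk (z + h) -> cmod (kpow a s (z + h) - kpow a s z) <= M * cmod h.
Proof.
move=> ha; have [M hM] := cpow_kernel_bounded (cmod a) (s - 1) ha.
exists ((`|s| * `|M|) *+ 2); first by rewrite mulrn_wge0// mulr_ge0.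
move=> z h hz hh.
have hd t : 0 <= t <= 1 -> cder (fun t => kpow a s (z + t%:C * h)) t
    (s%:C * (- (a^* * h)) * kpow a (s - 1) (z + t%:C * h)).
  by move=> t01; apply: cder_kpow => //; exact: disk_segment.
have -> : z + h = z + 1%:C * h by rewrite mul1r.
have -> : kpow a s z = kpow a s (z + 0%:C * h) by rewrite mul0r addr0.
rewrite mulrnAl; apply: (cmod_cder_le _ _ _ hd) => t t01.
rewrite (cmodM _ (kpow _ _ _)) cmodM cmod_real cmodN cmodM cmodJ.
rewrite -!mulrA ler_wpM2l// [`|M| * _]mulrC.
have hk : cmod (kpow a (s - 1) (z + t%:C * h)) <= `|M|.
  by apply: le_trans (ler_norm M); apply: hM => //; exact: disk_segment.
apply: le_trans (_ : 1 * (cmod h * `|M|) <= _); last by rewrite mul1r.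
apply: ler_pM; [exact: cmod_ge0|by rewrite mulr_ge0 ?cmod_ge0|exact: ltW|].
by rewrite ler_wpM2l ?cmod_ge0.
Qed.

(** Along the segment, the kernel power minus its tangent has a derivative of order |h|^2, by the
    Lipschitz bound for exponent s - 1; [cmod_cder_le] then bounds its increment. *)
Lemma kpow_taylor a s : disk a -> exists2 M : R, 0 <= M &
  forall z h, disk z -> disk (z + h) ->
  cmod (kpow a s (z + h) - kpow a s z - s%:C * (- a^*) * kpow a (s - 1) z * h)
    <= M * cmod h ^+ 2.
Proof.
move=> ha; have [M M0 hM] := kpow_lipschitz a (s - 1) ha.
exists ((`|s| * M) *+ 2); first by rewrite mulrn_wge0// mulr_ge0.
move=> z h hz hh.
pose e := s%:C * (- a^*) * kpow a (s - 1) z * h.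
pose q t := kpow a s (z + t%:C * h) - (0 + t%:C * e).
have hd t : 0 <= t <= 1 -> cder q t
    (s%:C * (- (a^* * h)) * (kpow a (s - 1) (z + t%:C * h) - kpow a (s - 1) z)).
  move=> t01.
  have k := cder_kpow a s z h t ha (disk_segment _ _ _ hz hh t01).
  apply: cder_eq (cderD _ _ _ _ _ k (cderN _ _ _ (cder_line 0 e t))) _.
  rewrite /e; move: (kpow _ _ _) (kpow _ _ _) => k1 k2; ring.
have -> : kpow a s (z + h) - kpow a s z - e = q 1 - q 0.
  rewrite /q !mul0r !mul1r !addr0 !add0r subr0.
  by move: (kpow _ _ _) (kpow _ _ _) => k1 k2; ring.
rewrite mulrnAl; apply: (cmod_cder_le _ _ _ hd) => t t01.
rewrite cmodM (cmodM s%:C) cmod_real cmodN cmodM cmodJ.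
rewrite -!mulrA ler_wpM2l//.
have hk : cmod (kpow a (s - 1) (z + t%:C * h) - kpow a (s - 1) z) <= M * cmod h.
  apply: le_trans (hM _ _ hz (disk_segment _ _ _ hz hh t01)) _.
  rewrite ler_wpM2l// cmodM cmod_real ger0_norm; last by case/andP: t01.
  by rewrite ler_piMl ?cmod_ge0//; case/andP: t01.
apply: le_trans (_ : 1 * (cmod h * (M * cmod h)) <= _).
  apply: ler_pM; [exact: cmod_ge0|by rewrite mulr_ge0 ?cmod_ge0|exact: ltW|].
  by rewrite ler_wpM2l ?cmod_ge0.
by rewrite mul1r expr2 mulrCA.
Qed.

Lemma holomorphic_kernel (F : R[i] -> R[i]) c a s : disk a ->
  (forall z, disk z -> F z = c * kpow a s z) -> holomorphic_on_disk F.
Proof.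
move=> ha hF z hz.
have [M M0 hM] := kpow_taylor a s ha.
apply: (derivable_quadratic F z (c * (s%:C * (- a^*) * kpow a (s - 1) z)) (cmod c * M)
  (1 - cmod z)); first by rewrite subr_gt0.
move=> h hh.
have hzh : disk (z + h).
  by rewrite /disk /=; apply: le_lt_trans (le_cmodD _ _) _; lra.
rewrite !hF//.
have -> : c * kpow a s (z + h) - c * kpow a s z - c * (s%:C * - a^* * kpow a (s - 1) z) * h
  = c * (kpow a s (z + h) - kpow a s z - s%:C * (- a^*) * kpow a (s - 1) z * h).
  by move: (kpow _ _ _) (kpow _ _ _) (kpow _ _ _) => k1 k2 k3; ring.
by rewrite cmodM -[leRHS]mulrA ler_wpM2l ?cmod_ge0// hM.
Qed.

Variable g : R.
Hypothesis g1 : -1 < g.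

(** One criterion for the normalized kernels and for their images under the operator: on the disk
    both are multiples of some [kpow], hence bounded. *)
Lemma is_bergman_kernel (F : R[i] -> R[i]) c a s : disk a ->
  (forall z, disk z -> F z = c * kpow a s z) -> is_bergman g F.
Proof.
move=> ha hF; split; first exact: holomorphic_kernel ha hF.
have [F1 F2] : cbmeas F.
  apply: (cbmeas_ext (fun z => c * kpow a s z)); first by move=> z /hF.
  by apply: cbmeasM (cbmeas_cst _) _; exact: cbmeas_kernel.
have hb := bmeasD _ _ (bmeasM _ _ F1 F1) (bmeasM _ _ F2 F2).
have /integrableP[_] := bmeas_integrable g g1 _ hb.
congr (_ < _)%E; apply: eq_integral => p _ /=.
rewrite sqr_cmod !expr2 ger0_norm// mulr_ge0 ?density_ge0// -!expr2.
by rewrite addr_ge0 ?sqr_ge0.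
Qed.

Lemma to_bergmanE (F : R[i] -> R[i]) : is_bergman g F -> sval (to_bergman g F) = F.
Proof. by rewrite /to_bergman; case: pselect. Qed.

(** * Action of the operator on the normalized kernels *)

Let kconst a : R := (1 - cmod a ^+ 2) `^ ((g + 2) / 2).

Lemma nkernelE xi w : disk xi -> disk w ->
  nkernel g xi w = (kconst xi)%:C * kpow xi (- (g + 2)) w.
Proof. by move=> hx hw; rewrite /nkernel /kpow cpowN// Re_kernel_gt0. Qed.

Lemma is_bergman_nkernel xi : disk xi -> is_bergman g (nkernel g xi).
Proof.
by move=> hx; apply: (is_bergman_kernel _ _ xi _ hx) => z hz; exact: nkernelE.
Qed.

Lemma kernel_neq0 a z : disk a -> disk z -> 1 - a^* * z != 0.
Proof.
by move=> ha hz; apply: contraTneq (Re_kernel_gt0 a z ha hz) => ->; rewrite ltxx.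
Qed.

(** From |1 - conj(b) w|^2 - |w - b|^2 = (1 - |b|^2) (1 - |w|^2). *)
Lemma disk_mobius b w : disk b -> disk w -> disk ((w - b) / (1 - b^* * w)).
Proof.
move=> hb hw; rewrite /disk /= cmodM cmodV.
have n0 : 0 < cmod (1 - b^* * w).
  by rewrite lt_neqAle cmod_ge0 eq_sym cmod_eq0 kernel_neq0.
rewrite ltr_pdivrMr// mul1r -ltr_sqr ?nnegrE ?cmod_ge0//.
have : 0 < (1 - cmod b ^+ 2) * (1 - cmod w ^+ 2).
  by rewrite mulr_gt0// subr_gt0 expr_lt1 ?cmod_ge0.
rewrite !sqr_cmod !(ReD, ImD, ReN, ImN, ReM, ImM, ReJ, ImJ) /=; lra.
Qed.

Lemma weyl_psi_disk b w : disk b -> disk w -> disk (psi b (-1) w).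
Proof.
move=> hb hw; rewrite /psi mulN1r /disk /= cmodN; exact: disk_mobius.
Qed.

(** This is the point [psi b (-1) xi]. For the sign -1 the map is an involution, so this is also the
    preimage of [xi]. *)
Let apt b xi := (b - xi) / (1 - xi * b^*).

Lemma disk_apt b xi : disk b -> disk xi -> disk (apt b xi).
Proof.
move=> hb hx; have := disk_mobius xi b hx hb; rewrite /disk /= !cmodM !cmodV.
suff -> : cmod (1 - xi^* * b) = cmod (1 - xi * b^*) by [].
by rewrite -cmodJ; congr cmod; rewrite rmorphB rmorphM /= conjCK conjC1.
Qed.

(** With a = [apt b xi] and p = [psi b (-1) w], the bases satisfy (1 - conj(b) w) (1 - conj(xi) p) =
    (1 - conj(xi) b) (1 - conj(a) w), two factors on each side as [cpow_mul2] requires. *)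
Lemma weyl_kernel b xi w : disk b -> disk xi -> disk w ->
  nkernel g b w * nkernel g xi (psi b (-1) w) =
  ((kconst b)%:C * (kconst xi)%:C * cpow (1 - xi^* * b) (- (g + 2))) *
    kpow (apt b xi) (- (g + 2)) w.
Proof.
move=> hb hx hw.
have hp := weyl_psi_disk b w hb hw; have ha := disk_apt b xi hb hx.
rewrite !nkernelE//.
have e : kpow b (- (g + 2)) w * kpow xi (- (g + 2)) (psi b (-1) w) =
    cpow (1 - xi^* * b) (- (g + 2)) * kpow (apt b xi) (- (g + 2)) w.
  apply: cpow_mul2; [exact: Re_kernel_gt0|exact: Re_kernel_gt0|exact: Re_kernel_gt0|exact: Re_kernel_gt0|].
  have n1 := kernel_neq0 _ _ hb hw; have n2 := kernel_neq0 _ _ hx hb.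
  rewrite /psi /apt.
  rewrite [((b - xi) / _)^*]rmorphM fmorphV !rmorphB rmorphM /= conjCK conjC1.
  by field; rewrite n1 n2.
move: e; move: (kpow _ _ _) (kpow _ _ _) (kpow _ _ _) (cpow _ _) => k1 k2 k3 k4 e.
transitivity ((kconst b)%:C * (kconst xi)%:C * (k3 * k2)); first by ring.
by rewrite e; ring.
Qed.

Definition weyl_base b xi : R :=
  (1 - cmod xi ^+ 2) * Num.sqrt (1 - cmod b ^+ 2) /
  (1 + cmod xi ^+ 2 - 2 * complex.Re (b^* * xi)).

Lemma weyl_denom_gt0 b xi : disk b -> disk xi ->
  0 < 1 + cmod xi ^+ 2 - 2 * complex.Re (b^* * xi).
Proof.
move=> hb hx.
have h : complex.Re (b^* * xi) <= cmod b * cmod xi.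
  by apply: le_trans (ler_norm _) _; rewrite -(cmodJ b) -cmodM le_Re_cmod.
(* For the moduli k of [b] and r of [xi], the quantity is at least (1 - r)^2 + 2 r (1 - k). *)
have := hb; have := hx; rewrite /disk /=.
have := cmod_ge0 b; have := cmod_ge0 xi; nra.
Qed.

Lemma berezin_weyl b xi : disk b -> disk xi ->
  berezin (weyl g b (-1)) xi = (weyl_base b xi `^ (g + 2))%:C.
Proof.
move=> hb hx.
have ha := disk_apt b xi hb hx.
(* Both the kernel and its image lie in the space, so neither use of [to_bergman] falls back on its
   default. *)
have hk := is_bergman_nkernel xi hx.
have hT : is_bergman g (fun w => nkernel g b w * nkernel g xi (psi b (-1) w)).
  by apply: (is_bergman_kernel _ _ _ _ ha) => z hz; exact: weyl_kernel.
rewrite /berezin /= /inner /weyl /wcomp (to_bergmanE _ hk) (to_bergmanE _ hT).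
set C := (kconst b)%:C * (kconst xi)%:C * cpow (1 - xi^* * b) (- (g + 2)).
transitivity (C * (kconst xi)%:C * kernel_form g (apt b xi) xi).
  rewrite -disk_integralZ//; last first.
    by apply: cbmeasM; [|apply: cbmeasJ]; exact: cbmeas_kernel.
  apply: disk_integral_ext => z hz; rewrite weyl_kernel// nkernelE// -/C.
  rewrite conjM conj_real.
  by move: (kpow _ _ _) (kpow _ _ _) => k1 k2; ring.
rewrite kernel_form_eq// /C.
set q := 1 + cmod xi ^+ 2 - 2 * complex.Re (b^* * xi).
have q0 : 0 < q by exact: weyl_denom_gt0.
(* The phases of the two powers cancel, since the product of their bases is the positive real number
   [q]. The factor 1 gives the right-hand side the second base needed by [cpow_mul2]. *)
have e : cpow (1 - xi^* * b) (- (g + 2)) * cpow (1 - (apt b xi)^* * xi) (- (g + 2)) =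
    cpow q%:C (- (g + 2)) * cpow 1 (- (g + 2)).
  apply: cpow_mul2; [exact: Re_kernel_gt0|exact: Re_kernel_gt0|exact: q0|exact: ltr01|].
  have n2 := kernel_neq0 _ _ hx hb.
  have -> : (1 - xi^* * b) * (1 - (apt b xi)^* * xi) =
      1 - xi^* * b - b^* * xi + xi * xi^*.
    rewrite /apt [((b - xi) / _)^*]rmorphM fmorphV !rmorphB rmorphM /= conjCK conjC1.
    by field.
  rewrite mulcJ /q sqr_cmod.
  by apply: eqC; rewrite !(ReD, ImD, ReN, ImN, ReM, ImM, ReJ, ImJ) /=; ring.
rewrite cpow_1r mulr1 cpow_real// in e.
transitivity ((kconst b)%:C * (kconst xi)%:C * (kconst xi)%:C * (q `^ (- (g + 2)))%:C).
  by rewrite -e; move: (cpow _ _) (cpow _ _) => k1 k2; ring.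
rewrite -!rcM; congr (_ %:C).
have x0 : 0 < 1 - cmod xi ^+ 2 by rewrite subr_gt0 expr_lt1 ?cmod_ge0.
have b0 : 0 < 1 - cmod b ^+ 2 by rewrite subr_gt0 expr_lt1 ?cmod_ge0.
rewrite /weyl_base -/q powRM ?mulr_ge0 ?sqrtr_ge0 ?invr_ge0 ?ltW//.
rewrite powRM ?sqrtr_ge0 ?(ltW x0)//.
have -> : q^-1 `^ (g + 2) = q `^ (- (g + 2)).
  by rewrite -powR_inv1 ?ltW// -powRrM mulN1r.
have -> : Num.sqrt (1 - cmod b ^+ 2) `^ (g + 2) = kconst b.
  by rewrite -powR12_sqrt ?ltW// -powRrM mulrC.
have -> : (1 - cmod xi ^+ 2) `^ (g + 2) = kconst xi * kconst xi.
  rewrite /kconst -powRD; last by rewrite (gt_eqF x0) implybT.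
  by congr (_ `^ _); field.
by ring.
Qed.

(** * Values taken by the base of the power *)

Lemma weyl_base_gt0 b xi : disk b -> disk xi -> 0 < weyl_base b xi.
Proof.
move=> hb hx; rewrite divr_gt0 ?weyl_denom_gt0// mulr_gt0 ?sqrtr_gt0//.
  by rewrite subr_gt0 expr_lt1 ?cmod_ge0.
by rewrite subr_gt0 expr_lt1 ?cmod_ge0.
Qed.

Lemma weyl_base_le1 b xi : disk b -> disk xi -> weyl_base b xi <= 1.
Proof.
move=> hb hx; rewrite ler_pdivrMr ?weyl_denom_gt0// mul1r.
have h : complex.Re (b^* * xi) <= cmod b * cmod xi.
  by apply: le_trans (ler_norm _) _; rewrite -(cmodJ b) -cmodM le_Re_cmod.
have b1 : 0 <= 1 - cmod b ^+ 2 by rewrite subr_ge0 ltW// expr_lt1 ?cmod_ge0.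
have := sqr_sqrtr b1; have := sqrtr_ge0 (1 - cmod b ^+ 2).
move: h (cmod_ge0 b) (cmod_ge0 xi) (hx : cmod xi < 1) {b1}.
move: (Num.sqrt _) => s; move: (complex.Re _) => u.
move: (cmod b) (cmod xi) => k r hu k0 r0 r1 s0 s2.
suff h : (1 - r ^+ 2) * s + 2 * (k * r) <= 1 + r ^+ 2 by lra.
have r2 : 0 <= 1 - r ^+ 2 by rewrite subr_ge0 expr_le1// ltW.
rewrite -ler_sqr ?nnegrE ?addr_ge0 ?sqr_ge0 ?mulr_ge0//.
(* Lagrange's identity for the vectors (1 - r^2, 2 r), of norm 1 + r^2, and (s, k), of norm 1. *)
have -> : (1 + r ^+ 2) ^+ 2 = ((1 - r ^+ 2) * s + 2 * (k * r)) ^+ 2 +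
    ((1 - r ^+ 2) * k - 2 * (r * s)) ^+ 2.
  transitivity (((1 - r ^+ 2) ^+ 2 + 4 * r ^+ 2) * (s ^+ 2 + k ^+ 2)); last by ring.
  by rewrite s2 subrK; ring.
by rewrite lerDl sqr_ge0.
Qed.

(* The witness has the direction of [b], and its modulus is a root of the
   quadratic equation [(1 - t^2) sqrt (1 - |b|^2) = x (1 + t^2 - 2 t |b|)]. *)
Lemma weyl_base_surj b (x : R) : disk b -> 0 < x <= 1 ->
  exists2 xi, disk xi & weyl_base b xi = x.
Proof.
move=> hb /andP[x0 x1].
pose k := cmod b; have k0 : 0 <= k by exact: cmod_ge0.
have k1 : k < 1 by exact: hb.
have k2 : 0 < 1 - k ^+ 2 by rewrite subr_gt0 expr_lt1.
pose s := Num.sqrt (1 - k ^+ 2); have s0 : 0 < s by rewrite sqrtr_gt0.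
have s2 : s ^+ 2 = 1 - k ^+ 2 by rewrite sqr_sqrtr// ltW.
have x2 : 0 <= 1 - x ^+ 2 by rewrite subr_ge0 expr_le1// ltW.
pose c := Num.sqrt (1 - x ^+ 2); have c0 : 0 <= c by exact: sqrtr_ge0.
have c2 : c ^+ 2 = 1 - x ^+ 2 by rewrite sqr_sqrtr.
have c1 : c <= 1.
  by rewrite -ler_sqr ?nnegrE// c2 expr1n gerBl sqr_ge0.
have xs0 : 0 < x + s by exact: addr_gt0.
(* The quadratic is (x + s) t^2 - 2 x k t + x - s = 0. As 1 - k^2 = s^2, its reduced discriminant is
   s^2 - x^2 s^2 = (s c)^2. The plus sign makes the root nonnegative, and k < 1, c <= 1 make it less
   than 1. *)
pose t := (x * k + s * c) / (x + s).
have t0 : 0 <= t by rewrite divr_ge0 ?addr_ge0 ?mulr_ge0// ltW.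
have t1 : t < 1.
  rewrite ltr_pdivrMr// mul1r ltr_leD//; first by rewrite gtr_pMr.
  by rewrite ger_pMr.
have [e [e1 eb]] : exists e : R[i], cmod e = 1 /\ complex.Re (b^* * e) = k.
  have [b0|b0] := eqVneq b 0.
    by exists 1; rewrite cmod1 /k b0 cmod0 conjC0 mul0r.
  have kn0 : k != 0 by rewrite cmod_eq0.
  exists (b / k%:C); rewrite cmodM cmodV cmod_real ger0_norm// divff//; split=> //.
  rewrite mulrA [b^* * b]mulrC mulcJ -rcV -rcM /= -/k.
  by field.
exists (t%:C * e).
  by rewrite /disk /= cmodM cmod_real e1 mulr1 ger0_norm.
have tE : complex.Re (b^* * (t%:C * e)) = t * k.
  by rewrite mulrCA ReM /= mul0r subr0 eb.
have d0 := weyl_denom_gt0 b (t%:C * e) hb.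
rewrite /weyl_base tE cmodM cmod_real e1 mulr1 ger0_norm// -/k -/s.
rewrite tE cmodM cmod_real e1 mulr1 ger0_norm// in d0.
have {}d0 : 0 < 1 + t ^+ 2 - 2 * (t * k).
  by apply: d0; rewrite /disk /= cmodM cmod_real e1 mulr1 ger0_norm.
apply: (canLR (mulfK _)); first by rewrite gt_eqF.
have xs : x + s != 0 by rewrite gt_eqF.
apply/eqP; rewrite -subr_eq0.
have tx : t * (x + s) = x * k + s * c by rewrite divfK.
apply/eqP; apply: (mulfI xs); rewrite mulr0.
transitivity (- ((t * (x + s)) ^+ 2 - 2 * x * k * (t * (x + s)) + x ^+ 2 - s ^+ 2)).
  by ring.
rewrite tx; transitivity (- (s ^+ 2 * c ^+ 2 - x ^+ 2 * k ^+ 2 + x ^+ 2 - s ^+ 2)); first by ring.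
by rewrite c2 s2; ring.
Qed.

End Berezin.

Theorem theorem3p3 (R : realType) (gamma : R) (beta : R[i])
    (hgamma : -1 < gamma) (hbeta : disk beta) :
  Ber (weyl gamma beta (-1)) = [set x%:C | x in `]0, 1]].
Proof.
have g0 : 0 < gamma + 2 by lra.
have p1 (s : R) : 1 `^ s = 1 by rewrite powR1.
apply/seteqP; split => z /=.
  move=> [xi hx <-]; rewrite berezin_weyl//.
  exists (weyl_base beta xi `^ (gamma + 2)) => //.
  rewrite in_itv /= powR_gt0 ?weyl_base_gt0//=.
  have w0 := weyl_base_gt0 _ _ hbeta hx; have w1 := weyl_base_le1 _ _ hbeta hx.
  rewrite -[leRHS](p1 (gamma + 2)).
  by rewrite ge0_ler_powR ?nnegrE// ltW.
move=> [x]; rewrite in_itv /= => /andP[x0 x1] <-.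
(* The root of order gamma + 2 stays in ]0, 1] and is the value to be attained by [weyl_base]. *)
have y1 : 0 < x `^ (gamma + 2)^-1 <= 1.
  rewrite powR_gt0//= -[leRHS](p1 (gamma + 2)^-1).
  by rewrite ge0_ler_powR ?nnegrE ?invr_ge0// ltW.
have [xi hx e] := weyl_base_surj _ _ hbeta y1.
exists xi => //; rewrite berezin_weyl// e -powRrM mulVf ?gt_eqF//.
by rewrite powRr1// ltW.
Qed.
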